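(* Let $A$ be a finite dimensional Frobenius algebra over a field $k$ and let $\mathbf T\xrightarrow{\varepsilon}A$ be a complete resolution of $A$ by $A$-bimodules. Then there exists a diagonal approximation $\widehat\Delta:\mathbf T\to\mathbf T\widehat\otimes_A\mathbf T$, and it is unique up to homotopy (of chain maps of complexes of $A$-bimodules).
   Context: A finite dimensional $k$-algebra $A$ is Frobenius if there is a non-degenerate bilinear form $\langle-,-\rangle:A\otimes_k A\to k$ with $\langle ab,c\rangle=\langle a,bc\rangle$. $A$-bimodules are modules over $A^{\mathrm e}=A\otimes_kA^{\mathrm{op}}$. A complete resolution $\mathbf T\xrightarrow{\varepsilon}A$ is an acyclic chain complex $\mathbf T=(T_i,d_i)_{i\in\mathbb Z}$ of finitely generated projective $A$-bimodules together with a factorization $d_0=\eta\varepsilon$, where $\varepsilon:T_0\to A$ is a surjective and $\eta:A\to T_{-1}$ an injective bimodule map; $\varepsilon$, extended by $0$ in nonzero degrees, is the augmentation. For complexes $C$ of right and $C'$ of left $A$-modules, the complete tensor product $C\widehat\otimes_AC'$ has components $(C\widehat\otimes_AC')_n=\prod_{i\in\mathbb Z}C_{n-i}\otimes_AC'_i$ and differential given by $x\otimes y\mapsto d(x)\otimes y+(-1)^{|x|}x\otimes d(y)$. A diagonal approximation is a chain map of complexes of $A$-bimodules $\widehat\Delta:\mathbf T\to\mathbf T\widehat\otimes_A\mathbf T$ with $(\varepsilon\widehat\otimes_A\varepsilon)\widehat\Delta=\varepsilon$, where $\varepsilon\widehat\otimes_A\varepsilon:\mathbf T\widehat\otimes_A\mathbf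 T\to A\otimes_AA=A$ is the projection to $T_0\otimes_AT_0$ in degree $0$ followed by $\varepsilon\otimes_A\varepsilon$. *)

(* Defs.v *)
From HB Require Import structures.
From mathcomp Require Import all_boot all_order all_algebra all_field.
From mathcomp Require Import ring_quotient.
From mathcomp Require Import boolp.
From mathcomp Require Import finmap.
From mathcomp.multinomials Require Import monalg.

Set Implicit Arguments.
Unset Strict Implicit.
Unset Printing Implicit Defensive.

Import GRing.Theory.
Local Open Scope ring_scope.

Definition frobenius (k : fieldType) (A : falgType k) : Prop :=
  exists b : A -> A -> k,
    [/\ (forall y, linear (fun x => b x y : k^o)),
        (forall x, linear (fun y => b x y : k^o)),
        (forall x y z, b (x * y) z = b x (y * z)),
        (forall x, (forall y, b x y = 0) -> x = 0) &
        (forall y, (forall x, b x y = 0) -> y = 0)].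

(* A module over A^e = A (x)_k A^op, given by the commuting actions of A (x) 1
   and 1 (x) A^op, both of which restrict on k to the k-module structure. *)
HB.mixin Record isBimodule (k : fieldType) (A : algType k) M
    of GRing.Lmodule k M := {
  lact : A -> M -> M;
  ract : M -> A -> M;
  lact_linearl : forall x, linear (fun a => lact a x);
  lact_linearr : forall a, linear (lact a);
  ract_linearl : forall a, linear (fun x => ract x a);
  ract_linearr : forall x, linear (ract x);
  lact1 : forall x, lact 1 x = x;
  ract1 : forall x, ract x 1 = x;
  lactM : forall a b x, lact (a * b) x = lact a (lact b x);
  ractM : forall a b x, ract x (a * b) = ract (ract x a) b;
  lractA : forall a x b, ract (lact a x) b = lact a (ract x b)
}.

#[short(type="bimodType")]
HB.structure Definition Bimodule (k : fieldType) (A : algType k) :=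
  {M of GRing.Lmodule k M & isBimodule k A M}.

Record bimod_hom (k : fieldType) (A : algType k) (M N : bimodType A) :=
  BimodHom {
    hom_fun :> {linear M -> N};
    hom_lact : forall a x, hom_fun (lact a x) = lact a (hom_fun x);
    hom_ract : forall x a, hom_fun (ract x a) = ract (hom_fun x) a
  }.

Section Bimodules.
Context (k : fieldType) (A : algType k).
Implicit Types M N : bimodType A.

Lemma lactDr M a : {morph (lact a : M -> M) : x y / x + y}.
Proof. by move=> x y; have := lact_linearr a 1 x y; rewrite !scale1r. Qed.

Lemma ractDl M a : {morph (fun x : M => ract x a) : x y / x + y}.
Proof. by move=> x y; have := ract_linearl a 1 x y; rewrite !scale1r. Qed.

Lemma lact0 M a : lact a (0 : M) = 0.
Proof. by apply: (addIr (lact a 0)); rewrite -lactDr !add0r. Qed.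

Lemma ract0 M a : ract (0 : M) a = 0.
Proof. by apply: (addIr (ract 0 a)); rewrite -ractDl !add0r. Qed.

Lemma lactZr M a c (x : M) : lact a (c *: x) = c *: lact a x.
Proof. by rewrite -[c *: x]addr0 lact_linearr lact0 addr0. Qed.

Lemma ractZl M a c (x : M) : ract (c *: x) a = c *: ract x a.
Proof. by rewrite -[c *: x]addr0 ract_linearl ract0 addr0. Qed.

Definition regular_bimod : Type := A.
HB.instance Definition _ := GRing.Algebra.on regular_bimod.

Fact regular_mul_linearl (y : A) : linear (fun x : A => x * y).
Proof. by move=> c u v; rewrite mulrDl scalerAl. Qed.

Fact regular_mul_linearr (x : A) : linear (fun y : A => x * y).
Proof. by move=> c u v; rewrite mulrDr scalerAr. Qed.

HB.instance Definition _ := @isBimodule.Build k A regular_bimod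
  (fun a x => a * x) (fun x a => x * a)
  regular_mul_linearl regular_mul_linearr
  regular_mul_linearl regular_mul_linearr
  (@mul1r A) (@mulr1 A) (fun a b x => esym (mulrA a b x))
  (fun a b x => mulrA x a b) (fun a x b => esym (mulrA a x b)).

(* Every x is a finite sum of terms a g b with g in the finite list s. *)
Definition fin_generated M : Prop :=
  exists s : seq M, forall x : M, exists t : seq (A * M * A),
    {subset [seq u.1.2 | u <- t] <= s} /\
    x = \sum_(u <- t) lact u.1.1 (ract u.1.2 u.2).

Definition projective (P : bimodType A) : Prop :=
  forall (M N : bimodType A) (g : bimod_hom M N) (f : bimod_hom P N),
    (forall y, exists x, g x = y) ->
    exists h : bimod_hom P M, forall x, g (h x) = f x.

End Bimodules.

Fact linear_comb (k : fieldType) (U V : lmodType k) (c : k) (f g : U -> V) :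
  linear f -> linear g -> linear (fun u => c *: f u + g u).
Proof.
move=> fL gL d u v; rewrite fL gL !scalerDr !scalerA [c * d]mulrC.
by rewrite addrACA.
Qed.

Section Tensor.
Context (k : fieldType) (A : algType k).

Section Object.
Context (M N : bimodType A).

Local Notation F := {malg k[(M * N)%type]}.
Local Notation gen x y := (<< (x, y) >> : F).

Inductive tens_relator : F -> Prop :=
| RelDl x x' y : tens_relator (gen (x + x') y - gen x y - gen x' y)
| RelDr x y y' : tens_relator (gen x (y + y') - gen x y - gen x y')
| RelZ c x y : tens_relator (gen (c *: x) y - c *: gen x y)
| RelA x a y : tens_relator (gen (ract x a) y - gen x (lact a y)).

(* The k-subspace of F spanned by the relators. *)
Definition tens_span (u : F) : Prop :=
  forall W : F -> Prop,
    W 0 -> (forall c v w, W v -> W w -> W (c *: v + w)) ->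
    (forall r, tens_relator r -> W r) -> W u.

Definition tens_null (u : F) : bool := `[< tens_span u >].

Fact tens_span0 : tens_span 0.
Proof. by move=> W. Qed.

Fact tens_spanP c v w : tens_span v -> tens_span w -> tens_span (c *: v + w).
Proof.
by move=> vS wS W W0 WP Wr; exact: (WP c v w (vS W W0 WP Wr) (wS W W0 WP Wr)).
Qed.

Fact tens_spanZ c v : tens_span v -> tens_span (c *: v).
Proof.
by move=> vS; rewrite -[_ *: _]addr0; exact: (tens_spanP c vS tens_span0).
Qed.

Fact tens_nullP u : reflect (tens_span u) (u \in tens_null).
Proof. exact: asboolP. Qed.

Fact tens_null_zmod : zmod_closed tens_null.
Proof.
split; first by apply/tens_nullP; exact: tens_span0.
move=> u v /tens_nullP uS /tens_nullP vS; apply/tens_nullP.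
by rewrite addrC -scaleN1r; apply: tens_spanP.
Qed.
HB.instance Definition _ := GRing.isZmodClosed.Build F tens_null tens_null_zmod.

Local Notation Q := (Quotient.quot (GRing.ZmodClosed.clone F tens_null _)).

Definition tens : Type := Q.
HB.instance Definition _ := GRing.Zmodule.on tens.

Definition tens_class (u : F) : tens := (\pi_Q u)%qT.

Definition tens_repr (t : tens) : F := repr (t : Q).

Lemma tens_reprK : cancel tens_repr tens_class.
Proof. exact: reprK. Qed.

Lemma tens_class_eq u v : tens_class u = tens_class v <-> tens_span (u - v).
Proof.
rewrite /tens_class; split.
  by move/eqP; rewrite -Quotient.idealrBE => /tens_nullP.
by move=> uv; apply/eqP; rewrite -Quotient.idealrBE; apply/tens_nullP.
Qed.

Lemma tens_classD u v : tens_class (u + v) = tens_class u + tens_class v.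
Proof. exact: raddfD. Qed.

Lemma tens_class_surj (t : tens) : exists u, t = tens_class u.
Proof. by exists (tens_repr t); rewrite tens_reprK. Qed.

Definition tens_scale (c : k) (t : tens) : tens := tens_class (c *: tens_repr t).

Lemma tens_scale_class c u : tens_scale c (tens_class u) = tens_class (c *: u).
Proof.
apply/tens_class_eq; rewrite -scalerBr; apply: tens_spanZ.
by apply/tens_class_eq; rewrite tens_reprK.
Qed.

Fact tens_scaleA a b t : tens_scale a (tens_scale b t) = tens_scale (a * b) t.
Proof.
by case: (tens_class_surj t) => u ->; rewrite !tens_scale_class scalerA.
Qed.

Fact tens_scale1 : left_id 1 tens_scale.
Proof.
by move=> t; case: (tens_class_surj t) => u ->; rewrite tens_scale_class scale1r.
Qed.

Fact tens_scaleDr : right_distributive tens_scale +%R.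
Proof.
move=> c t t'; case: (tens_class_surj t) => u ->.
case: (tens_class_surj t') => v ->.
by rewrite -tens_classD !tens_scale_class scalerDr tens_classD.
Qed.

Fact tens_scaleDl t : {morph tens_scale^~ t : a b / a + b}.
Proof.
move=> a b; case: (tens_class_surj t) => u ->.
by rewrite !tens_scale_class scalerDl tens_classD.
Qed.

HB.instance Definition _ := GRing.Zmodule_isLmodule.Build k tens
  tens_scaleA tens_scale1 tens_scaleDr tens_scaleDl.

Definition tmul (x : M) (y : N) : tens := tens_class (gen x y).

Lemma tens_class_is_linear : linear tens_class.
Proof. by move=> c u v; rewrite tens_classD -tens_scale_class. Qed.

Lemma tmulDl x x' y : tmul (x + x') y = tmul x y + tmul x' y.
Proof.
rewrite /tmul -tens_classD; apply/tens_class_eq.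
by rewrite opprD addrA => W _ _ Wr; apply: Wr; exact: RelDl.
Qed.

Lemma tmulDr x y y' : tmul x (y + y') = tmul x y + tmul x y'.
Proof.
rewrite /tmul -tens_classD; apply/tens_class_eq.
by rewrite opprD addrA => W _ _ Wr; apply: Wr; exact: RelDr.
Qed.

Lemma tmulZl c x y : tmul (c *: x) y = c *: tmul x y.
Proof.
rewrite /tmul [RHS]tens_scale_class; apply/tens_class_eq.
by move=> W _ _ Wr; apply: Wr; exact: RelZ.
Qed.

Lemma tmul0l y : tmul 0 y = 0.
Proof. by have := tmulZl 0 0 y; rewrite !scale0r. Qed.

Lemma tmulA x a y : tmul (ract x a) y = tmul x (lact a y).
Proof. by apply/tens_class_eq => W _ _ Wr; apply: Wr; exact: RelA. Qed.

Lemma tmulZr c x y : tmul x (c *: y) = c *: tmul x y.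
Proof.
have lZ : lact (c *: 1 : A) y = c *: y.
  have := lact_linearl y c 1 0; rewrite addr0 lact1 => ->.
  suff -> : lact (0 : A) y = 0 by rewrite addr0.
  have := lact_linearl y (-1) (0 : A) 0.
  by rewrite scaleN1r oppr0 addr0 => ->; rewrite scaleN1r addNr.
have rZ : ract x (c *: 1 : A) = c *: x.
  have := ract_linearr x c 1 0; rewrite addr0 ract1 => ->.
  suff -> : ract x (0 : A) = 0 by rewrite addr0.
  have := ract_linearr x (-1) (0 : A) 0.
  by rewrite scaleN1r oppr0 addr0 => ->; rewrite scaleN1r addNr.
by rewrite -tmulZl -rZ -lZ tmulA.
Qed.

Lemma tmul0r x : tmul x 0 = 0.
Proof. by have := tmulZr 0 x 0; rewrite !scale0r. Qed.

Section Lift.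
Context (V : lmodType k).

Record balanced (f : M -> N -> V) : Prop := Balanced {
  balancedl : forall y, linear (fun x => f x y);
  balancedr : forall x, linear (f x);
  balancedA : forall x a y, f (ract x a) y = f x (lact a y)
}.

Definition free_lift (f : M -> N -> V) (u : F) : V :=
  \sum_(p <- msupp u) mcoeff p u *: f p.1 p.2.

(* The linear map induced by f on the tensor product; only meaningful for
   balanced f. *)
Definition tens_lift (f : M -> N -> V) (t : tens) : V := free_lift f (tens_repr t).

Lemma free_liftEw f (u : F) (d : {fset (M * N)%type}) : (msupp u `<=` d)%fset ->
  free_lift f u = \sum_(p <- d) mcoeff p u *: f p.1 p.2.
Proof.
move=> le_ud; rewrite /free_lift; apply: big_fset_incl => // p _ pu.
by rewrite mcoeff_outdom // scale0r.
Qed.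

Lemma free_lift_is_linear f : linear (free_lift f).
Proof.
move=> c u v; pose d := (msupp u `|` msupp v)%fset.
rewrite (@free_liftEw _ (c *: u + v) d); last first.
  apply: fsubset_trans (msuppD_le _ _) _.
  by apply: fsetSU; apply: msuppZ_le.
rewrite (@free_liftEw _ u d) ?fsubsetUl // (@free_liftEw _ v d) ?fsubsetUr //.
rewrite scaler_sumr -big_split /=; apply: eq_bigr => p _.
by rewrite mcoeffD mcoeffZ scalerDl scalerA.
Qed.

Lemma free_lift_gen f x y : free_lift f (gen x y) = f x y.
Proof.
by rewrite /free_lift msuppU oner_eq0 big_seq_fset1 mcoeffUU scale1r.
Qed.

Context (f : M -> N -> V) (fB : balanced f).

Lemma free_lift_span u : tens_span u -> free_lift f u = 0.
Proof.
have fL := free_lift_is_linear f.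
have f0 : free_lift f 0 = 0 by rewrite /free_lift msupp0 big_seq_fset0.
have fZ c v : free_lift f (c *: v) = c *: free_lift f v.
  by rewrite -[_ *: v]addr0 fL f0 addr0.
have fD v w : free_lift f (v + w) = free_lift f v + free_lift f w.
  by rewrite -[v]scale1r fL !scale1r.
have fN v : free_lift f (- v) = - free_lift f v.
  by rewrite -[- v]scaleN1r fZ scaleN1r.
move=> uS; apply: (uS (fun v => free_lift f v = 0)); first exact: f0.
  by move=> c v w v0 w0; rewrite fL v0 w0 scaler0 addr0.
move=> _ [x x' y|x y y'|c x y|x a y];
  rewrite ?(fD, fN, fZ, free_lift_gen); apply/eqP.
- have := balancedl fB y 1 x x'; rewrite !scale1r => ->.
  by rewrite addrAC addrK subrr.
- have := balancedr fB x 1 y y'; rewrite !scale1r => ->.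
  by rewrite addrAC addrK subrr.
- have := balancedl fB y c x 0.
  have := balancedl fB y (-1) (0 : M) 0.
  rewrite !scaleN1r oppr0 !addr0 addNr => -> ->.
  by rewrite addr0 subrr.
- by rewrite (balancedA fB) subrr.
Qed.

Lemma tens_lift_class u : tens_lift f (tens_class u) = free_lift f u.
Proof.
rewrite /tens_lift; set v := tens_repr _.
have /tens_class_eq uv : tens_class v = tens_class u.
  by rewrite /v tens_reprK.
have := free_lift_span uv; rewrite addrC -scaleN1r free_lift_is_linear.
by rewrite scaleN1r addrC => /eqP; rewrite subr_eq0 => /eqP.
Qed.

Lemma tens_lift_tmul x y : tens_lift f (tmul x y) = f x y.
Proof. by rewrite tens_lift_class free_lift_gen. Qed.

Lemma tens_lift_is_linear : linear (tens_lift f).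
Proof.
move=> c t t'; case: (tens_class_surj t) => u ->.
case: (tens_class_surj t') => v ->.
by rewrite -tens_class_is_linear !tens_lift_class free_lift_is_linear.
Qed.

End Lift.

Lemma tens_ind (P : tens -> Prop) :
  P 0 -> (forall t t', P t -> P t' -> P (t + t')) ->
  (forall x y, P (tmul x y)) -> forall t, P t.
Proof.
move=> P0 PD Pt t; case: (tens_class_surj t) => u ->; rewrite (monalgE u).
have cB : {morph tens_class : v w / v + w} := tens_classD.
have c0 : tens_class 0 = 0 by apply: raddf0.
rewrite (big_morph _ cB c0); elim/big_ind: _ => // p _.
have -> : << mcoeff p u *g p >> = mcoeff p u *: gen p.1 p.2.
  apply/malgP => q; rewrite mcoeffZ !mcoeffU -surjective_pairing.
  by rewrite mulr_natr.
have -> : tens_class (mcoeff p u *: gen p.1 p.2) = tmul (mcoeff p u *: p.1) p.2.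
  by rewrite tmulZl -tens_scale_class.
exact: Pt.
Qed.

Lemma tens_eq_linear (V : lmodType k) (f g : tens -> V) :
  linear f -> linear g ->
  (forall x y, f (tmul x y) = g (tmul x y)) -> f =1 g.
Proof.
move=> fL gL fg.
have lin0 (h : tens -> V) : linear h -> h 0 = 0.
  move=> hL; have := hL (-1) 0 0.
  by rewrite scaleN1r oppr0 addr0 scaleN1r addNr.
have linD (h : tens -> V) : linear h -> {morph h : u v / u + v}.
  by move=> hL u v; rewrite -[u]scale1r hL !scale1r.
elim/tens_ind => [|t t' tE t'E|//]; first by rewrite !lin0.
by rewrite !linD // tE t'E.
Qed.

Definition tens_lact (a : A) : tens -> tens :=
  tens_lift (fun x y => tmul (lact a x) y).
Definition tens_ract (t : tens) (a : A) : tens :=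
  tens_lift (fun x y => tmul x (ract y a)) t.

Fact tens_lact_balanced a : balanced (fun x y => tmul (lact a x) y).
Proof.
split=> [y c u v|x c u v|x b y].
- by rewrite lact_linearr tmulDl tmulZl.
- by rewrite tmulDr tmulZr.
- by rewrite -lractA tmulA.
Qed.

Fact tens_ract_balanced a : balanced (fun x y => tmul x (ract y a)).
Proof.
split=> [y c u v|x c u v|x b y].
- by rewrite tmulDl tmulZl.
- by rewrite ract_linearl tmulDr tmulZr.
- by rewrite lractA tmulA.
Qed.

Lemma tens_lact_tmul a x y : tens_lact a (tmul x y) = tmul (lact a x) y.
Proof. exact/tens_lift_tmul/tens_lact_balanced. Qed.

Lemma tens_ract_tmul x y a : tens_ract (tmul x y) a = tmul x (ract y a).
Proof. exact/tens_lift_tmul/tens_ract_balanced. Qed.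

Fact tens_lact_linearr a : linear (tens_lact a).
Proof. exact/tens_lift_is_linear/tens_lact_balanced. Qed.

Fact tens_ract_linearl a : linear (fun t => tens_ract t a).
Proof. exact/tens_lift_is_linear/tens_ract_balanced. Qed.

Fact tens_lact_linearl t : linear (fun a => tens_lact a t).
Proof.
move=> c a b; move: t; apply: tens_eq_linear.
- exact: tens_lact_linearr.
- by apply: linear_comb; apply: tens_lact_linearr.
- by move=> x y; rewrite !tens_lact_tmul lact_linearl tmulDl tmulZl.
Qed.

Fact tens_ract_linearr t : linear (tens_ract t).
Proof.
move=> c a b; move: t; apply: tens_eq_linear.
- exact: tens_ract_linearl.
- by apply: linear_comb; apply: tens_ract_linearl.
- by move=> x y; rewrite !tens_ract_tmul ract_linearr tmulDr tmulZr.
Qed.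

Fact tens_lact1 t : tens_lact 1 t = t.
Proof.
move: t; apply: tens_eq_linear; [exact: tens_lact_linearr | by [] |].
by move=> x y; rewrite tens_lact_tmul lact1.
Qed.

Fact tens_ract1 t : tens_ract t 1 = t.
Proof.
move: t; apply: tens_eq_linear; [exact: tens_ract_linearl | by [] |].
by move=> x y; rewrite tens_ract_tmul ract1.
Qed.

Fact tens_lactM a b t : tens_lact (a * b) t = tens_lact a (tens_lact b t).
Proof.
move: t; apply: tens_eq_linear; first exact: tens_lact_linearr.
  by move=> c u v; rewrite !tens_lact_linearr.
by move=> x y; rewrite !tens_lact_tmul lactM.
Qed.

Fact tens_ractM a b t : tens_ract t (a * b) = tens_ract (tens_ract t a) b.
Proof.
move: t; apply: tens_eq_linear; first exact: tens_ract_linearl.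
  by move=> c u v; rewrite !tens_ract_linearl.
by move=> x y; rewrite !tens_ract_tmul ractM.
Qed.

Fact tens_lractA a t b :
  tens_ract (tens_lact a t) b = tens_lact a (tens_ract t b).
Proof.
move: t; apply: tens_eq_linear.
- by move=> c u v; rewrite tens_lact_linearr tens_ract_linearl.
- by move=> c u v; rewrite tens_ract_linearl tens_lact_linearr.
- by move=> x y; rewrite !(tens_ract_tmul, tens_lact_tmul).
Qed.

HB.instance Definition _ := @isBimodule.Build k A tens tens_lact tens_ract
  tens_lact_linearl tens_lact_linearr tens_ract_linearl tens_ract_linearr
  tens_lact1 tens_ract1 tens_lactM tens_ractM tens_lractA.

End Object.

Section Functor.
Context (M N M' N' : bimodType A) (f : bimod_hom M M') (g : bimod_hom N N').

Definition tens_map_fun : tens M N -> tens M' N' :=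
  tens_lift (fun x y => tmul (f x) (g y)).

Fact tens_map_balanced : balanced (fun x y => tmul (f x) (g y)).
Proof.
split=> [y c u v|x c u v|x a y].
- by rewrite linearP tmulDl tmulZl.
- by rewrite linearP tmulDr tmulZr.
- by rewrite hom_ract hom_lact tmulA.
Qed.

Lemma tens_map_tmul x y : tens_map_fun (tmul x y) = tmul (f x) (g y).
Proof. exact/tens_lift_tmul/tens_map_balanced. Qed.

Fact tens_map_is_linear : linear tens_map_fun.
Proof. exact/tens_lift_is_linear/tens_map_balanced. Qed.

HB.instance Definition _ :=
  GRing.isLinear.Build k (tens M N) (tens M' N') _ tens_map_fun
    tens_map_is_linear.

Fact tens_map_lact a t : tens_map_fun (lact a t) = lact a (tens_map_fun t).
Proof.
move: t; apply: tens_eq_linear.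
- by move=> c u v; rewrite lact_linearr linearP.
- by move=> c u v; rewrite linearP lact_linearr.
- move=> x y; rewrite [lact a (tmul x y)]tens_lact_tmul !tens_map_tmul.
  by rewrite hom_lact [RHS]tens_lact_tmul.
Qed.

Fact tens_map_ract t a : tens_map_fun (ract t a) = ract (tens_map_fun t) a.
Proof.
move: t; apply: tens_eq_linear.
- by move=> c u v; rewrite ract_linearl linearP.
- by move=> c u v; rewrite linearP ract_linearl.
- move=> x y; rewrite [ract (tmul x y) a]tens_ract_tmul !tens_map_tmul.
  by rewrite hom_ract [RHS]tens_ract_tmul.
Qed.

Definition tens_map : bimod_hom (tens M N) (tens M' N') :=
  BimodHom tens_map_lact tens_map_ract.

End Functor.

Definition id_hom (M : bimodType A) : bimod_hom M M :=
  @BimodHom k A M M idfun (fun a x => erefl) (fun x a => erefl).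

Lemma tens_map_comp (M N M' N' M'' N'' : bimodType A)
    (f : bimod_hom M M') (g : bimod_hom N N')
    (f' : bimod_hom M' M'') (g' : bimod_hom N' N'')
    (h : tens M N -> tens M'' N'') : linear h ->
  (forall x y, h (tmul x y) = tmul (f' (f x)) (g' (g y))) ->
  forall t, tens_map f' g' (tens_map f g t) = h t.
Proof.
move=> hL hE; apply: tens_eq_linear => // [c u v|x y].
  by rewrite !linearP.
by rewrite hE [tens_map f g _]tens_map_tmul [LHS]tens_map_tmul.
Qed.

(* The canonical identification of A (x)_A A with A. *)
Definition tens_unit : tens (regular_bimod A) (regular_bimod A) -> A :=
  tens_lift (fun x y : regular_bimod A => x * y).

Lemma tens_unit_tmul (x y : regular_bimod A) : tens_unit (tmul x y) = x * y.
Proof.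
apply: (tens_lift_tmul (V := regular_bimod A)).
split=> [z|z|u a v]; [exact: regular_mul_linearl | exact: regular_mul_linearr |].
by rewrite /ract /lact /= mulrA.
Qed.

End Tensor.

Section Product.
Context (k : fieldType) (A : algType k) (I : Type) (M : I -> bimodType A).

Definition bimod_prod : Type := forall i, M i.
HB.instance Definition _ := Choice.on bimod_prod.

Fact bimod_prod_addA :
  associative (fun (x y : bimod_prod) (i : I) => x i + y i).
Proof.
by move=> x y z; apply: functional_extensionality_dep => i; rewrite addrA.
Qed.
Fact bimod_prod_addC :
  commutative (fun (x y : bimod_prod) (i : I) => x i + y i).
Proof.
by move=> x y; apply: functional_extensionality_dep => i; rewrite addrC.
Qed.
Fact bimod_prod_add0 :
  left_id (fun i => 0) (fun (x y : bimod_prod) (i : I) => x i + y i).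
Proof.
by move=> x; apply: functional_extensionality_dep => i; rewrite add0r.
Qed.
Fact bimod_prod_addN :
  left_inverse (fun i => 0) (fun (x : bimod_prod) i => - x i)
    (fun (x y : bimod_prod) (i : I) => x i + y i).
Proof.
by move=> x; apply: functional_extensionality_dep => i; rewrite addNr.
Qed.

HB.instance Definition _ := @GRing.isZmodule.Build bimod_prod
  (fun i => 0) (fun x i => - x i) (fun x y i => x i + y i)
  bimod_prod_addA bimod_prod_addC bimod_prod_add0 bimod_prod_addN.

Definition bimod_prod_scale (c : k) (x : bimod_prod) : bimod_prod :=
  fun i => c *: x i.

Fact bimod_prod_scaleA a b x :
  bimod_prod_scale a (bimod_prod_scale b x) = bimod_prod_scale (a * b) x.
Proof. by apply: functional_extensionality_dep => i; apply: scalerA. Qed.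
Fact bimod_prod_scale1 : left_id 1 bimod_prod_scale.
Proof.
by move=> x; apply: functional_extensionality_dep => i; apply: scale1r.
Qed.
Fact bimod_prod_scaleDr : right_distributive bimod_prod_scale +%R.
Proof.
by move=> c x y; apply: functional_extensionality_dep => i; apply: scalerDr.
Qed.
Fact bimod_prod_scaleDl x : {morph bimod_prod_scale^~ x : a b / a + b}.
Proof.
by move=> a b; apply: functional_extensionality_dep => i; apply: scalerDl.
Qed.

HB.instance Definition _ := GRing.Zmodule_isLmodule.Build k bimod_prod
  bimod_prod_scaleA bimod_prod_scale1 bimod_prod_scaleDr bimod_prod_scaleDl.

Definition bimod_prod_lact (a : A) (x : bimod_prod) : bimod_prod :=
  fun i => lact a (x i).
Definition bimod_prod_ract (x : bimod_prod) (a : A) : bimod_prod :=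
  fun i => ract (x i) a.

Fact bimod_prod_lact_linearl x : linear (fun a => bimod_prod_lact a x).
Proof.
by move=> c a b; apply: functional_extensionality_dep => i; apply: lact_linearl.
Qed.
Fact bimod_prod_lact_linearr a : linear (bimod_prod_lact a).
Proof.
by move=> c x y; apply: functional_extensionality_dep => i; apply: lact_linearr.
Qed.
Fact bimod_prod_ract_linearl a : linear (fun x => bimod_prod_ract x a).
Proof.
by move=> c x y; apply: functional_extensionality_dep => i; apply: ract_linearl.
Qed.
Fact bimod_prod_ract_linearr x : linear (bimod_prod_ract x).
Proof.
by move=> c a b; apply: functional_extensionality_dep => i; apply: ract_linearr.
Qed.
Fact bimod_prod_lact1 x : bimod_prod_lact 1 x = x.
Proof. by apply: functional_extensionality_dep => i; apply: lact1. Qed.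
Fact bimod_prod_ract1 x : bimod_prod_ract x 1 = x.
Proof. by apply: functional_extensionality_dep => i; apply: ract1. Qed.
Fact bimod_prod_lactM a b x :
  bimod_prod_lact (a * b) x = bimod_prod_lact a (bimod_prod_lact b x).
Proof. by apply: functional_extensionality_dep => i; apply: lactM. Qed.
Fact bimod_prod_ractM a b x :
  bimod_prod_ract x (a * b) = bimod_prod_ract (bimod_prod_ract x a) b.
Proof. by apply: functional_extensionality_dep => i; apply: ractM. Qed.
Fact bimod_prod_lractA a x b :
  bimod_prod_ract (bimod_prod_lact a x) b
  = bimod_prod_lact a (bimod_prod_ract x b).
Proof. by apply: functional_extensionality_dep => i; apply: lractA. Qed.

HB.instance Definition _ := @isBimodule.Build k A bimod_prod
  bimod_prod_lact bimod_prod_ract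
  bimod_prod_lact_linearl bimod_prod_lact_linearr
  bimod_prod_ract_linearl bimod_prod_ract_linearr
  bimod_prod_lact1 bimod_prod_ract1 bimod_prod_lactM bimod_prod_ractM
  bimod_prod_lractA.

End Product.

(* The differential leaving degree i + 1 is indexed by its target degree i, so
   that [diff C i] is the map usually written d_{i+1}. *)
Record complex (k : fieldType) (A : algType k) := Complex {
  obj :> int -> bimodType A;
  diff : forall i : int, bimod_hom (obj (i + 1)) (obj i);
  diff_diff : forall (i : int) x, diff i (diff (i + 1) x) = 0
}.

Record chain_map (k : fieldType) (A : algType k) (C C' : complex A) :=
  ChainMap {
    chain_fun :> forall i : int, bimod_hom (C i) (C' i);
    chain_comm : forall (i : int) (x : C (i + 1)),
      chain_fun i (diff C i x) = diff C' i (chain_fun (i + 1) x)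
  }.

(* As every integer is of the form i + 1, this is
   f_n - g_n = d_{n+1} h_n + h_{n-1} d_n for all n. *)
Definition homotopic (k : fieldType) (A : algType k) (C C' : complex A)
    (f g : chain_map C C') : Prop :=
  exists h : forall i : int, bimod_hom (C i) (C' (i + 1)),
    forall (i : int) (x : C (i + 1)),
      f (i + 1) x - g (i + 1) x
      = diff C' (i + 1) (h (i + 1) x) + h i (diff C i x).

Definition acyclic (k : fieldType) (A : algType k) (C : complex A) : Prop :=
  forall (i : int) (x : C (i + 1)),
    diff C i x = 0 -> exists y : C (i + 1 + 1), diff C (i + 1) y = x.

(* The factorization uses that T (-1 + 1) and T 0 are convertible. *)
Definition complete_resolution (k : fieldType) (A : algType k)
    (T : complex A) (eps : bimod_hom (T 0) (regular_bimod A)) : Prop :=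
  [/\ acyclic T,
      (forall i : int, fin_generated (T i) /\ projective (T i)),
      (forall a : A, exists x, eps x = a) &
      exists eta : bimod_hom (regular_bimod A) (T (-1)),
        injective eta /\ forall x : T 0, diff T (-1) x = eta (eps x)].

Section CompleteTensor.
Context (k : fieldType) (A : algType k) (C C' : complex A).

(* The pairs (p, q) with p + q = n, i.e. the pairs (n - i, i). *)
Record antidiag (n : int) := Antidiag {
  adl : int;
  adr : int;
  _ : adl + adr == n
}.

Definition ctens_obj (n : int) : bimodType A :=
  bimod_prod (fun s : antidiag n => tens (C (adl s)) (C' (adr s))).

Fact antidiagSl (n p q : int) : p + q == n -> p + 1 + q == n + 1.
Proof. by move=> /eqP <-; rewrite addrAC. Qed.

Fact antidiagSr (n p q : int) : p + q == n -> p + (q + 1) == n + 1.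
Proof. by move=> /eqP <-; rewrite addrA. Qed.

(* The component at (p, q) receives (d (x) 1) from (p + 1, q) and
   (-1)^p (1 (x) d) from (p, q + 1). *)
Definition ctens_diff_fun (n : int) (x : ctens_obj (n + 1)) : ctens_obj n :=
  fun s : antidiag n =>
    let: Antidiag p q pq := s in
      tens_map (diff C p) (id_hom (C' q)) (x (Antidiag (antidiagSl pq)))
      + ((-1 : k) ^ p) *:
        tens_map (id_hom (C p)) (diff C' q) (x (Antidiag (antidiagSr pq))).

Fact ctens_diff_is_linear n : linear (@ctens_diff_fun n).
Proof.
move=> c x y; apply: functional_extensionality_dep => -[p q pq].
have xyE s : (c *: x + y) s = c *: x s + y s by [].
rewrite /ctens_diff_fun xyE xyE.
set f := tens_map _ _; set g := tens_map _ _.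
rewrite (linearP f) (linearP g) [RHS]/(c *: (_ + _) + (_ + _)).
by rewrite !scalerDr !scalerA [c * _]mulrC addrACA.
Qed.

HB.instance Definition _ n :=
  GRing.isLinear.Build k (ctens_obj (n + 1)) (ctens_obj n) _ (@ctens_diff_fun n)
    (@ctens_diff_is_linear n).

Fact ctens_diff_lact n a (x : ctens_obj (n + 1)) :
  ctens_diff_fun (lact a x) = lact a (ctens_diff_fun x).
Proof.
apply: functional_extensionality_dep => -[p q pq].
have axE m (y : ctens_obj m) s : lact a y s = lact a (y s) by [].
rewrite axE /ctens_diff_fun !axE !hom_lact.
by rewrite lactDr lactZr.
Qed.

Fact ctens_diff_ract n (x : ctens_obj (n + 1)) a :
  ctens_diff_fun (ract x a) = ract (ctens_diff_fun x) a.
Proof.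
apply: functional_extensionality_dep => -[p q pq].
have xaE m (y : ctens_obj m) s : ract y a s = ract (y s) a by [].
rewrite xaE /ctens_diff_fun !xaE !hom_ract.
by rewrite ractDl ractZl.
Qed.

Definition ctens_diff n : bimod_hom (ctens_obj (n + 1)) (ctens_obj n) :=
  BimodHom (@ctens_diff_lact n) (@ctens_diff_ract n).

Lemma ctens_diffE n (x : ctens_obj (n + 1)) (p q : int) (pq : p + q == n) :
  ctens_diff n x (Antidiag pq) =
    tens_map (diff C p) (id_hom (C' q)) (x (Antidiag (antidiagSl pq)))
    + ((-1 : k) ^ p) *:
      tens_map (id_hom (C p)) (diff C' q) (x (Antidiag (antidiagSr pq))).
Proof. by []. Qed.

Fact ctens_diff_diff n (x : ctens_obj (n + 1 + 1)) :
  ctens_diff n (ctens_diff (n + 1) x) = 0.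
Proof.
apply: functional_extensionality_dep => -[p q pq].
rewrite ctens_diffE !ctens_diffE.
have -> : antidiagSl (antidiagSr pq) = antidiagSr (antidiagSl pq).
  exact: bool_irrelevance.
have lin0 (U V : bimodType A) : linear (fun _ : U => 0 : V).
  by move=> c u v; rewrite scaler0 addr0.
have ddl t : tens_map (diff C p) (id_hom (C' q))
    (tens_map (diff C (p + 1)) (id_hom (C' q)) t) = 0.
  apply: (tens_map_comp (h := fun=> 0)) => [|y z]; first exact: lin0.
  by rewrite diff_diff tmul0l.
have ddr t : tens_map (id_hom (C p)) (diff C' q)
    (tens_map (id_hom (C p)) (diff C' (q + 1)) t) = 0.
  apply: (tens_map_comp (h := fun=> 0)) => [|y z]; first exact: lin0.
  by rewrite diff_diff tmul0r.
have dlr t : tens_map (diff C p) (id_hom (C' q))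
    (tens_map (id_hom (C (p + 1))) (diff C' q) t)
  = tens_map (id_hom (C p)) (diff C' q)
    (tens_map (diff C p) (id_hom (C' (q + 1))) t).
  transitivity (tens_map (diff C p) (diff C' q) t).
    apply: tens_map_comp => [c u v|y z]; first by rewrite linearP.
    exact: tens_map_tmul.
  apply/esym/tens_map_comp => [c u v|y z]; first by rewrite linearP.
  exact: tens_map_tmul.
rewrite !linearD !linearZ /= ddl ddr dlr !scaler0 addr0 add0r.
rewrite expfzDr ?oppr_eq0 ?oner_eq0 // expr1z mulrN1 scaleNr.
exact: addNr.
Qed.

Definition ctens : complex A := Complex ctens_diff_diff.

End CompleteTensor.

Section DiagonalApproximation.
Context (k : fieldType) (A : algType k) (T : complex A).
Context (eps : bimod_hom (T 0) (regular_bimod A)).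

(* eps (x)^ eps in degree 0: the projection to T_0 (x)_A T_0 followed by
   eps (x)_A eps; in the other degrees it is 0. *)
Definition ctens_augmentation (x : ctens T T 0) : A :=
  tens_unit (tens_map eps eps (x (@Antidiag 0 0 0 (eqxx 0)))).

Definition diagonal_approximation (Delta : chain_map T (ctens T T)) : Prop :=
  forall x : T 0, ctens_augmentation (Delta 0 x) = eps x.

End DiagonalApproximation.

(* Main.v *)
(** Let [e_i], [f_i] be dual bases for the Frobenius form.  By Higman's criterion,
    a projective bimodule P has a k-linear endomorphism [th] with
    [sum_(i, j) e_i th(f_i x e_j) f_j = x], so averaging over the dual bases turns
    k-linear liftings out of P and extensions into P into bimodule ones.  One-sided
    averaging shows that T is contractible as a complex of right A-modules
    (starting from a splitting of the factorization through A), hence that each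
    [T_p (x) T] is contractible as a complex of bimodules, while each [T (x) T_q]
    is contractible over k.

    A chain map or a homotopy from T to the complete tensor product is a family of
    columns, the p-th one with values in [T_p (x) T], and its equation relates the
    columns p and p + 1.  Column 0 is prescribed through [eps (x) 1], as a lift of
    the identity of T (existence), or of a null-homotopy of
    [(eps (x) 1)(Delta - Delta')] (uniqueness); the columns p > 0 follow from the
    exactness of [T (x) T_q] and the columns p < 0 from the contractions of
    [T_p (x) T].  No boundedness is involved, since the components form a product. *)
From HB Require Import structures.
Require Import Defs.
From mathcomp Require Import all_boot all_order all_algebra all_field.
From mathcomp Require Import boolp.

Set Implicit Arguments.
Unset Strict Implicit.
Unset Printing Implicit Defensive.

Import GRing.Theory.
Local Open Scope ring_scope.

(** * Families indexed by the integers *)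

Lemma int_shift (X : int -> Type) (G : forall n, X (n + 1)) :
  exists F : forall n, X n, forall n, F (n + 1) = G n.
Proof.
(* [n - 1 + 1] equals [n] only propositionally, so [G (n - 1)] is transported along [subrK]; [castG]
   removes the transport. *)
exists (fun n => ecast m (X m) (subrK 1 n) (G (n - 1))) => n.
have castG m (mn : m + 1 = n + 1) : ecast i (X i) mn (G m) = G n.
  have mE : m = n by apply: addIr mn.
  by subst m; rewrite (eq_irrelevance mn erefl).
exact: castG.
Qed.

Section IntegerRecursion.
Context (X : int -> Type) (R : forall p, X p -> X (p + 1) -> Prop).
Arguments R : clear implicits.

(** Dependent choice run upwards and downwards from [b]. The values are built at [b + i], so that
    the constructors of the offset [i] give two structural recursions. *)
Lemma int_recursion (b : int) (x0 : X b) :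
  (forall p x, exists y, R p x y) -> (forall p y, exists x, R p x y) ->
  exists F : forall p, X p, F b = x0 /\ forall p, R p (F p) (F (p + 1)).
Proof.
move=> /= upE dnE.
pose up p x := projT1 (cid (upE p x)); pose dn p y := projT1 (cid (dnE p y)).
have upP p x : R p x (up p x) by rewrite /up; case: cid.
have dnP p y : R p (dn p y) y by rewrite /dn; case: cid.
pose cst p q (E : p = q) (x : X p) : X q := ecast i (X i) E x.
have cstK p q r (E : p = q) (E' : q = r) (E'' : p = r) x :
    cst q r E' (cst p q E x) = cst p r E'' x.
  by case: r / E' E'' => E''; rewrite (eq_irrelevance E'' E).
have cst1 p (E : p = p) x : cst p p E x = x by rewrite (eq_irrelevance E erefl).
have uE m : b + m%:Z + 1 = b + m.+1%:Z by rewrite -addrA -addn1 PoszD.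
pose fix u (m : nat) : X (b + m%:Z) :=
  if m is m'.+1 then cst _ _ (uE m') (up _ (u m'))
  else cst _ _ (esym (addr0 b)) x0.
have dE0 : b = b + Negz 0 + 1 by rewrite NegzE subrK.
have dES m : b + Negz m = b + Negz m.+1 + 1.
  by rewrite !NegzE -[m.+2]addn1 PoszD opprD addrA subrK.
pose fix d (m : nat) : X (b + Negz m) :=
  if m is m'.+1 then dn _ (cst _ _ (dES m') (d m'))
  else dn _ (cst _ _ dE0 x0).
pose K (i : int) : X (b + i) := match i with Posz m => u m | Negz m => d m end.
(* An arbitrary proof [E] of the index equation lets composite transports be merged by [cstK]. *)
have KP i j (E : b + j = b + i + 1) : R (b + i) (K i) (cst _ _ E (K j)).
  have jE : j = i + 1 by apply: (@addrI _ b); rewrite E addrA.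
  (* A step up from [b], the step from [b - 1] to [b] where the two recursions meet, and a step
     further down. *)
  case: i E jE => [m|[|m]] E jE.
  - have jE' : j = m.+1%:Z by rewrite jE -addn1 PoszD.
    clear jE; subst j.
    change (R (b + m%:Z) (u m) (cst _ _ E (cst _ _ (uE m) (up _ (u m))))).
    by rewrite (cstK _ _ _ _ _ (erefl _)) cst1; exact: upP.
  - have jE' : j = 0%:Z by rewrite jE NegzE.
    clear jE; subst j.
    change (R _ (dn _ (cst _ _ dE0 x0))
      (cst _ _ E (cst _ _ (esym (addr0 b)) x0))).
    by rewrite (cstK _ _ _ _ _ dE0); exact: dnP.
  - have jE' : j = Negz m by rewrite jE !NegzE -[m.+2]addn1 PoszD opprD subrK.
    clear jE; subst j; change (R _ (dn _ (cst _ _ (dES m) (d m))) (cst _ _ E (d m))).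
    by rewrite (eq_irrelevance E (dES m)); exact: dnP.
have E0 p : b + (p - b) = p by rewrite addrC subrK.
exists (fun p => cst _ _ (E0 p) (K (p - b))); split.
  have K0 i (E : b + i = b) : cst _ _ E (K i) = x0.
    have iE : i = 0%:Z by apply: (@addrI _ b); rewrite E addr0.
    subst i; change (cst _ _ E (cst _ _ (esym (addr0 b)) x0) = x0).
    by rewrite (cstK _ _ _ _ _ (erefl b)).
  exact: K0.
move=> p; have gen i j (E : b + i = p) (E' : b + j = p + 1) :
    R p (cst _ _ E (K i)) (cst _ _ E' (K j)).
  by subst p; rewrite cst1.
exact: gen.
Qed.

End IntegerRecursion.

(** A term can be continued only when it comes with a neighbour related to it, so [int_recursion] is
    applied to related pairs, consecutive pairs being required to overlap. *)
Lemma int_chain (X : int -> Type) (R : forall p, X p -> X (p + 1) -> Prop)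
    (b : int) (x0 : X b) (x1 : X (b + 1)) : R b x0 x1 ->
  (forall p x y, R p x y -> exists z, R (p + 1) y z) ->
  (forall p y z, R (p + 1) y z -> exists x, R p x y) ->
  exists F : forall p, X p, F b = x0 /\ forall p, R p (F p) (F (p + 1)).
Proof.
move=> R0 upR dnR.
pose S p := {xy : X p * X (p + 1) | R p xy.1 xy.2}.
pose J p (s : S p) (t : S (p + 1)) := (sval t).1 = (sval s).2.
have [||F [F0 FJ]] := @int_recursion S J b (exist _ (x0, x1) R0).
- move=> p [[x y] /= xy]; have [z yz] := upR _ _ _ xy.
  by exists (exist _ (y, z) yz).
- move=> p [[y z] /= yz]; have [x xy] := dnR _ _ _ yz.
  by exists (exist _ (x, y) xy).
exists (fun p => (sval (F p)).1); split; first by rewrite F0.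
by move=> p; rewrite FJ; exact: svalP (F p).
Qed.

(** * Linear algebra over a field *)

Section LinearFunctions.
Context (k : fieldType) (U V : lmodType k).

Definition pack_linear (f : U -> V) (fL : linear f) : {linear U -> V} :=
  HB.pack f (GRing.isLinear.Build k U V _ f fL).

Context (f : U -> V) (fL : linear f).

Lemma lin0 : f 0 = 0.
Proof. exact: (linear0 (pack_linear fL)). Qed.

Lemma linB : {morph f : x y / x - y}.
Proof. exact: (linearB (pack_linear fL)). Qed.

Lemma linZ c : {morph f : x / c *: x}.
Proof. exact: (linearZ_LR (pack_linear fL)). Qed.

Lemma lin_sum I (r : seq I) (P : pred I) (F : I -> U) :
  f (\sum_(i <- r | P i) F i) = \sum_(i <- r | P i) f (F i).
Proof. exact: (linear_sum (pack_linear fL)). Qed.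

End LinearFunctions.

Section FiniteDimension.
Context (k : fieldType).

Definition finitely_spanned (M : lmodType k) : Prop :=
  exists n (t : 'I_n -> M), forall x, exists a : 'I_n -> k, x = \sum_i a i *: t i.

(** A spanning family of least size is free. This transfers the linear algebra of row vectors to
    modules given without a basis. *)
Lemma coordinates (M : lmodType k) : finitely_spanned M ->
  exists n (phi : M -> 'rV[k]_n) (psi : 'rV[k]_n -> M),
    [/\ linear phi, linear psi, cancel phi psi & cancel psi phi].
Proof.
move=> Mfin.
pose sp n := `[< exists t : 'I_n -> M,
  forall x, exists a : 'I_n -> k, x = \sum_i a i *: t i >].
have /ex_minnP[n /asboolP[t tP] n_min] : exists n, sp n.
  by case: Mfin => n tP; exists n; apply/asboolP.
have t_free (a : 'I_n -> k) : \sum_i a i *: t i = 0 -> forall i, a i = 0.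
  case: n => [|n] in t tP n_min a *; first by move=> _ [].
  move=> a0 i; apply: contrapT => /eqP ai.
  suff /n_min : sp n by rewrite ltnn.
  (* A nontrivial relation expresses [t i] through the other members, which then span, against
     minimality. *)
  have tiE : t i = \sum_j (- (a i)^-1 * a (lift i j)) *: t (lift i j).
    apply: (scalerI ai); rewrite scaler_sumr.
    move: a0; rewrite (bigD1_ord i) //= => /eqP; rewrite addr_eq0 => /eqP ->.
    rewrite -sumrN; apply: eq_bigr => j _.
    by rewrite scalerA mulrA mulrN divff // mulN1r scaleNr.
  apply/asboolP; exists (fun j => t (lift i j)) => x; have [b ->] := tP x.
  exists (fun j => b i * (- (a i)^-1 * a (lift i j)) + b (lift i j)).
  rewrite (bigD1_ord i) //= {1}tiE scaler_sumr -big_split /=.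
  by apply: eq_bigr => j _; rewrite scalerA scalerDl.
pose psi (v : 'rV[k]_n) := \sum_i v 0 i *: t i.
have psiL : linear psi.
  move=> c u v; rewrite /psi scaler_sumr -big_split /=; apply: eq_bigr => i _.
  by rewrite !mxE scalerDl scalerA.
have psi_surj x : exists v, psi v = x.
  have [a ->] := tP x; exists (\row_i a i).
  by apply: eq_bigr => i _; rewrite mxE.
pose phi x := projT1 (cid (psi_surj x)).
have phiK : cancel phi psi by move=> x; rewrite /phi; case: cid.
have psi_inj : injective psi.
  move=> u v uv; apply/rowP => i; apply/eqP; rewrite -subr_eq0; apply/eqP.
  have -> : u 0 i - v 0 i = (u - v) 0 i by rewrite !mxE.
  by apply: t_free; rewrite -[LHS]/(psi (u - v)) (linB psiL) uv subrr.
exists n, phi, psi; split=> // [c x y|]; last exact: inj_can_sym phiK psi_inj.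
by apply: psi_inj; rewrite psiL !phiK.
Qed.

(** In coordinates [d] becomes a map [g] of row vectors, and [g^-1] is a right inverse of [g] on its
    image. *)
Lemma generalized_inverse (M N : lmodType k) (d : M -> N) : linear d ->
  finitely_spanned M -> finitely_spanned N ->
  exists c : N -> M, linear c /\ forall x, d (c (d x)) = d x.
Proof.
move=> dL /coordinates[m [phi [psi [phiL psiL phiK psiK]]]].
move=> /coordinates[n [phi' [psi' [phiL' psiL' phiK' psiK']]]].
have gL : linear (fun v => phi' (d (psi v))) by move=> c u v; rewrite psiL dL phiL'.
pose g := linfun (pack_linear gL).
exists (fun y => psi ((g^-1)%VF (phi' y))); split=> [c u v|x].
  by rewrite phiL' linearP psiL.
have gE v : g v = phi' (d (psi v)) by rewrite lfunE.
have /limg_lfunVK := memv_img g (memvf (phi x)).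
by rewrite !gE phiK => /(can_inj phiK').
Qed.

End FiniteDimension.

(** * Dual bases of a Frobenius algebra *)

Section FrobeniusBasis.
Context (k : fieldType).

(** Duality is recorded by the two expansions, the form in which averaging uses it, rather than by
    [lam (f i * e j)] being a Kronecker delta. *)
Record dual_bases (A : algType k) n (lam : A -> k) (e f : 'I_n -> A) : Prop :=
  DualBases {
    lam_linear : linear (lam : A -> k^o);
    sum_dual_e : forall x, \sum_i lam (f i * x) *: e i = x;
    sum_dual_f : forall x, \sum_i lam (x * e i) *: f i = x
  }.

(** By non-degeneracy the map sending x to the row of all [lam (x * e j)] is injective, hence
    bijective by dimension; [f i] is the preimage of the i-th unit vector. *)
Lemma frobenius_dual_bases (A : falgType k) : frobenius A ->
  exists n lam (e f : 'I_n -> A), dual_bases lam e f.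
Proof.
move=> [b [bLl bLr bM b_ndl _]].
pose lam x := b 1 x; have bE x y : b x y = lam (x * y) by rewrite /lam -bM mul1r.
pose n := \dim {:A}; pose e := tnth (vbasis {:A}).
have lamL : linear (lam : A -> k^o) by exact: bLr.
have phiL : linear (fun f => \row_j lam (f * e j) : 'rV[k]_n).
  by move=> c u v; apply/rowP => j; rewrite !mxE mulrDl -scalerAl lamL.
pose phi := linfun (pack_linear phiL).
have eP x : x = \sum_i coord (vbasis {:A}) i x *: e i.
  rewrite {1}(coord_vbasis (memvf x)); apply: eq_bigr => i _.
  by rewrite /e (tnth_nth 0).
have phi_inj f f' : (forall j, lam (f * e j) = lam (f' * e j)) -> f = f'.
  move=> ff'; apply/eqP; rewrite -subr_eq0; apply/eqP; apply: b_ndl => y.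
  rewrite bE [y]eP mulr_sumr (lin_sum lamL) big1 // => i _.
  rewrite -scalerAr (linZ lamL) mulrBl (linB lamL).
  by rewrite ff' subrr scaler0.
have phi_ker : lker phi = 0%VS.
  apply/eqP/lker0P => f f' /rowP ff'; apply: phi_inj => j.
  by have := ff' j; rewrite !lfunE !mxE.
have phi_img : limg phi = fullv.
  have := limg_ker_dim phi fullv; rewrite phi_ker capv0 dimv0 add0n => dim_phi.
  by apply/eqP; rewrite eqEdim subvf /= dim_phi dimvf /dim /= mul1n.
pose f i := (phi^-1)%VF (delta_mx 0 i).
have fE i j : lam (f i * e j) = (j == i)%:R.
  have : phi (f i) = delta_mx 0 i by rewrite limg_lfunVK // phi_img memvf.
  by move/rowP/(_ j); rewrite lfunE !mxE.
exists n, lam, e, f; split=> // x.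
  rewrite [RHS]eP; apply: eq_bigr => i _; congr (_ *: _).
  rewrite {1}[x]eP mulr_sumr (lin_sum lamL) (bigD1 i) //= big1 => [|j ji].
    by rewrite -scalerAr (linZ lamL) fE eqxx addr0; exact: mulr1.
  by rewrite -scalerAr (linZ lamL) fE (negPf ji) scaler0.
apply: phi_inj => j; rewrite mulr_suml (lin_sum lamL) (bigD1 j) //= big1 => [|i ij].
  by rewrite -scalerAl (linZ lamL) fE eqxx addr0; exact: mulr1.
by rewrite -scalerAl (linZ lamL) fE eq_sym (negPf ij) scaler0.
Qed.

Context (A : algType k) (n : nat) (lam : A -> k) (e f : 'I_n -> A).
Context (ef : dual_bases lam e f).

(* [sum_i a e_i (x) f_i = sum_i e_i (x) f_i a] in A (x)_k A, tested against
   bilinear maps. *)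
Lemma casimir (V : lmodType k) (B : A -> A -> V) :
  (forall y, linear (B^~ y)) -> (forall x, linear (B x)) ->
  forall a, \sum_i B (a * e i) (f i) = \sum_i B (e i) (f i * a).
Proof.
move=> BLl BLr a.
(* The coefficients [lam (f j * a * e i)] expand both [a * e i] in the [e j] and [f j * a] in the
   [f i]. *)
transitivity (\sum_i \sum_j lam (f j * a * e i) *: B (e j) (f i)).
  apply: eq_bigr => i _; rewrite -{1}[a * e i](sum_dual_e ef) (lin_sum (BLl _)).
  by apply: eq_bigr => j _; rewrite (linZ (BLl _)) mulrA.
rewrite exchange_big; apply: eq_bigr => j _ /=.
rewrite -[in RHS](sum_dual_f ef (f j * a)) (lin_sum (BLr _)).
by apply: eq_bigr => i _; rewrite (linZ (BLr _)).
Qed.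

End FrobeniusBasis.

(** * Bimodule maps and their averages over the dual bases *)

Section Homs.
Context (k : fieldType) (A : algType k).
Implicit Types M N P : bimodType A.

Definition mk_bimod_hom M N (f : M -> N) (fL : linear f)
    (fl : forall a x, f (lact a x) = lact a (f x))
    (fr : forall x a, f (ract x a) = ract (f x) a) : bimod_hom M N :=
  @BimodHom k A M N (pack_linear fL) fl fr.

Lemma hom_linear M N (f : bimod_hom M N) : linear f.
Proof. by move=> c x y; rewrite linearP. Qed.

Lemma lact_suml M I (r : seq I) (a : I -> A) (x : M) :
  lact (\sum_(i <- r) a i) x = \sum_(i <- r) lact (a i) x.
Proof. exact: (lin_sum (lact_linearl x)). Qed.

Lemma lact_sumr M I (r : seq I) a (x : I -> M) :
  lact a (\sum_(i <- r) x i) = \sum_(i <- r) lact a (x i).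
Proof. exact: (lin_sum (lact_linearr a)). Qed.

Lemma ract_suml M I (r : seq I) (x : I -> M) a :
  ract (\sum_(i <- r) x i) a = \sum_(i <- r) ract (x i) a.
Proof. exact: (lin_sum (ract_linearl a)). Qed.

Lemma ract_sumr M I (r : seq I) (x : M) (a : I -> A) :
  ract x (\sum_(i <- r) a i) = \sum_(i <- r) ract x (a i).
Proof. exact: (lin_sum (ract_linearr x)). Qed.

Lemma lactZl M c a (x : M) : lact (c *: a) x = c *: lact a x.
Proof. exact: (linZ (lact_linearl x)). Qed.

Lemma ractZr M c a (x : M) : ract x (c *: a) = c *: ract x a.
Proof. exact: (linZ (ract_linearr x)). Qed.

Lemma ractBl M a : {morph (fun x : M => ract x a) : x y / x - y}.
Proof. exact: (linB (ract_linearl a)). Qed.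

End Homs.

Section Transfer.
Context (k : fieldType) (A : algType k) (n : nat) (lam : A -> k).
Context (e f : 'I_n -> A) (ef : dual_bases lam e f).
Implicit Types M N P : bimodType A.

(** Relative traces: they turn a k-linear map into a right, respectively left, A-linear one, because
    [casimir] moves a scalar across the sum. *)
Definition rtransfer M N (w : M -> N) x := \sum_i ract (w (ract x (e i))) (f i).
Definition ltransfer M N (w : M -> N) x := \sum_i lact (e i) (w (lact (f i) x)).

Lemma rtransfer_linear M N (w : M -> N) : linear w -> linear (rtransfer w).
Proof.
move=> wL c x y; rewrite /rtransfer scaler_sumr -big_split; apply: eq_bigr => i _.
by rewrite ract_linearl wL ract_linearl.
Qed.

Lemma ltransfer_linear M N (w : M -> N) : linear w -> linear (ltransfer w).
Proof.
move=> wL c x y; rewrite /ltransfer scaler_sumr -big_split; apply: eq_bigr => i _.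
by rewrite lact_linearr wL lact_linearr.
Qed.

Lemma rtransfer_ract M N (w : M -> N) x a :
  linear w -> rtransfer w (ract x a) = ract (rtransfer w x) a.
Proof.
move=> wL; rewrite /rtransfer ract_suml.
under eq_bigr do rewrite -ractM.
under [RHS]eq_bigr do rewrite -ractM.
apply: (casimir ef (B := fun u v => ract (w (ract x u)) v)) => [v|u] c u1 u2.
  by rewrite ract_linearr wL ract_linearl.
by rewrite ract_linearr.
Qed.

Lemma ltransfer_lact M N (w : M -> N) a x :
  linear w -> ltransfer w (lact a x) = lact a (ltransfer w x).
Proof.
move=> wL; rewrite /ltransfer lact_sumr.
under eq_bigr do rewrite -lactM.
under [RHS]eq_bigr do rewrite -lactM.
apply/esym/(casimir ef (B := fun u v => lact u (w (lact v x)))) => [v|u] c u1 u2.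
  by rewrite lact_linearl.
by rewrite lact_linearl wL lact_linearr.
Qed.

Lemma ltransfer_ract M N (w : M -> N) x a :
  (forall x, w (ract x a) = ract (w x) a) ->
  ltransfer w (ract x a) = ract (ltransfer w x) a.
Proof.
move=> wr; rewrite /ltransfer ract_suml; apply: eq_bigr => i _.
by rewrite -lractA wr lractA.
Qed.

Definition transfer M N (w : M -> N) : M -> N := ltransfer (rtransfer w).

Lemma transferE M N (w : M -> N) x : transfer w x =
  \sum_i \sum_j lact (e i) (ract (w (ract (lact (f i) x) (e j))) (f j)).
Proof. by apply: eq_bigr => i _; rewrite lact_sumr. Qed.

Lemma transfer_linear M N (w : M -> N) : linear w -> linear (transfer w).
Proof. by move=> wL; apply: ltransfer_linear; apply: rtransfer_linear. Qed.

Lemma transfer_lact M N (w : M -> N) a x :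
  linear w -> transfer w (lact a x) = lact a (transfer w x).
Proof. by move=> wL; apply: ltransfer_lact; apply: rtransfer_linear. Qed.

Lemma transfer_ract M N (w : M -> N) x a :
  linear w -> transfer w (ract x a) = ract (transfer w x) a.
Proof. by move=> wL; apply: ltransfer_ract => y; apply: rtransfer_ract. Qed.

Definition transfer_hom M N (w : M -> N) (wL : linear w) : bimod_hom M N :=
  mk_bimod_hom (transfer_linear wL) (fun a x => transfer_lact a x wL)
    (fun x a => transfer_ract x a wL).

Lemma transfer_post M N P (g : bimod_hom N P) (w : M -> N) x :
  g (transfer w x) = transfer (g \o w) x.
Proof.
rewrite !transferE linear_sum; apply: eq_bigr => i _.
rewrite linear_sum; apply: eq_bigr => j _ /=.
by rewrite hom_lact hom_ract.
Qed.

Lemma transfer_pre M N P (w : N -> P) (g : bimod_hom M N) x :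
  transfer w (g x) = transfer (w \o g) x.
Proof.
rewrite !transferE; apply: eq_bigr => i _; apply: eq_bigr => j _ /=.
by rewrite hom_ract hom_lact.
Qed.

Lemma eq_transfer M N (w w' : M -> N) : w =1 w' -> transfer w =1 transfer w'.
Proof.
move=> ww' x; rewrite !transferE; apply: eq_bigr => i _; apply: eq_bigr => j _.
by rewrite ww'.
Qed.

Lemma dual_unit_e : \sum_i lam (f i) *: e i = 1.
Proof. by rewrite -[RHS](sum_dual_e ef); apply: eq_bigr => i _; rewrite mulr1. Qed.

Lemma dual_unit_f : \sum_i lam (e i) *: f i = 1.
Proof. by rewrite -[RHS](sum_dual_f ef); apply: eq_bigr => i _; rewrite mul1r. Qed.

End Transfer.

(** * Coinduced bimodules and Higman's criterion *)

Section Coinduced.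
Context (k : fieldType) (A : algType k) (P : bimodType A).

Local Notation fam := (bimod_prod (fun _ : A * A => P)).

Definition bilinear_fam : {pred fam} := fun F =>
  `[< (forall v, linear (fun u => F (u, v))) /\
      (forall u, linear (fun v => F (u, v))) >].

Fact bilinear_fam_submod : submod_closed bilinear_fam.
Proof.
split=> [|c F G /asboolP[Fl Fr] /asboolP[Gl Gr]]; apply/asboolP.
  by split=> ? c u v; rewrite [RHS]addr0 scaler0.
have E u : (c *: F + G) u = c *: F u + G u by [].
split=> w d u v; rewrite !E.
  by rewrite Fl Gl !scalerDr !scalerA [c * d]mulrC addrACA.
by rewrite Fr Gr !scalerDr !scalerA [c * d]mulrC addrACA.
Qed.
HB.instance Definition _ :=
  GRing.isSubmodClosed.Build k fam bilinear_fam bilinear_fam_submod.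

(* Hom_k(A (x)_k A, P), the bimodule coinduced from the k-module P. *)
Definition coinduced : Type := {F : fam | F \in bilinear_fam}.
HB.instance Definition _ := SubType.on coinduced.
HB.instance Definition _ := [Choice of coinduced by <:].
HB.instance Definition _ := [SubChoice_isSubLmodule of coinduced by <:].

Lemma coindP (F : coinduced) :
  (forall v, linear (fun u => val F (u, v))) /\
  (forall u, linear (fun v => val F (u, v))).
Proof. exact/asboolP/(valP F). Qed.

Lemma coind_eq (F G : coinduced) : (forall u v, val F (u, v) = val G (u, v)) -> F = G.
Proof.
by move=> FG; apply/val_inj/functional_extensionality_dep => -[u v].
Qed.

Fact coind_lact_subproof a (F : coinduced) :
  ((fun uv => val F (uv.1 * a, uv.2)) : fam) \in bilinear_fam.
Proof.
have [Fl Fr] := coindP F; apply/asboolP; split=> [v|u] c x y /=; last exact: Fr.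
by rewrite mulrDl -scalerAl Fl.
Qed.

Fact coind_ract_subproof (F : coinduced) a :
  ((fun uv => val F (uv.1, a * uv.2)) : fam) \in bilinear_fam.
Proof.
have [Fl Fr] := coindP F; apply/asboolP; split=> [v|u] c x y /=; first exact: Fl.
by rewrite mulrDr -scalerAr Fr.
Qed.

Definition coind_lact a F : coinduced :=
  exist (fun F : fam => F \in bilinear_fam) _ (coind_lact_subproof a F).
Definition coind_ract F a : coinduced :=
  exist (fun F : fam => F \in bilinear_fam) _ (coind_ract_subproof F a).

Lemma coind_valD c (F G : coinduced) u : val (c *: F + G) u = c *: val F u + val G u.
Proof. by rewrite linearP. Qed.

Fact coind_lact_linearl F : linear (fun a => coind_lact a F).
Proof.
move=> c a b; apply: coind_eq => u v; rewrite coind_valD /=.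
by rewrite mulrDr -scalerAr (coindP F).1.
Qed.

Fact coind_lact_linearr a : linear (coind_lact a).
Proof.
by move=> c F G; apply: coind_eq => u v; rewrite coind_valD; exact: coind_valD.
Qed.

Fact coind_ract_linearl a : linear (fun F => coind_ract F a).
Proof.
by move=> c F G; apply: coind_eq => u v; rewrite coind_valD; exact: coind_valD.
Qed.

Fact coind_ract_linearr F : linear (coind_ract F).
Proof.
move=> c a b; apply: coind_eq => u v; rewrite coind_valD /=.
by rewrite mulrDl -scalerAl (coindP F).2.
Qed.

Fact coind_lact1 F : coind_lact 1 F = F.
Proof. by apply: coind_eq => u v /=; rewrite mulr1. Qed.

Fact coind_ract1 F : coind_ract F 1 = F.
Proof. by apply: coind_eq => u v /=; rewrite mul1r. Qed.

Fact coind_lactM a b F : coind_lact (a * b) F = coind_lact a (coind_lact b F).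
Proof. by apply: coind_eq => u v /=; rewrite mulrA. Qed.

Fact coind_ractM a b F : coind_ract F (a * b) = coind_ract (coind_ract F a) b.
Proof. by apply: coind_eq => u v /=; rewrite mulrA. Qed.

Fact coind_lractA a F b :
  coind_ract (coind_lact a F) b = coind_lact a (coind_ract F b).
Proof. by apply: coind_eq. Qed.

HB.instance Definition _ := @isBimodule.Build k A coinduced coind_lact coind_ract
  coind_lact_linearl coind_lact_linearr coind_ract_linearl coind_ract_linearr
  coind_lact1 coind_ract1 coind_lactM coind_ractM coind_lractA.

End Coinduced.

Section Higman.
Context (k : fieldType) (A : algType k) (n : nat) (lam : A -> k).
Context (e f : 'I_n -> A) (ef : dual_bases lam e f).
Context (P : bimodType A).

(** The dual bases identify the coinduced bimodule with the induced one, the tensor product of A, P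
    and A over k; this is then the action map sending a (x) x (x) b to axb. *)
Definition coind_eval (F : coinduced P) : P :=
  \sum_i \sum_j lact (e i) (ract (val F (f i, e j)) (f j)).

Fact coind_eval_linear : linear coind_eval.
Proof.
move=> c F G; rewrite /coind_eval scaler_sumr -big_split; apply: eq_bigr => i _.
rewrite scaler_sumr -big_split; apply: eq_bigr => j _.
by rewrite coind_valD ract_linearl lact_linearr.
Qed.

Fact coind_eval_lact a F : coind_eval (lact a F) = lact a (coind_eval F).
Proof.
have [Fl Fr] := coindP F; rewrite /coind_eval lact_sumr.
pose G u := \sum_j ract (val F (u, e j)) (f j).
have GL : linear G.
  move=> c u v; rewrite /G scaler_sumr -big_split; apply: eq_bigr => j _.
  by rewrite Fl ract_linearl.
transitivity (\sum_i lact (e i) (G (f i * a))).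
  by apply: eq_bigr => i _; rewrite lact_sumr.
transitivity (\sum_i lact (a * e i) (G (f i))).
  apply/esym/(casimir ef (B := fun u v => lact u (G v))) => [v|u] c u1 u2.
    by rewrite lact_linearl.
  by rewrite GL lact_linearr.
by apply: eq_bigr => i _; rewrite lactM -lact_sumr.
Qed.

Fact coind_eval_ract F a : coind_eval (ract F a) = ract (coind_eval F) a.
Proof.
have [Fl Fr] := coindP F; rewrite /coind_eval ract_suml; apply: eq_bigr => i _.
rewrite ract_suml.
transitivity (\sum_j lact (e i) (ract (val F (f i, e j)) (f j * a))).
  apply: (casimir ef (B := fun u v => lact (e i) (ract (val F (f i, u)) v))).
    by move=> v c u1 u2; rewrite Fr ract_linearl lact_linearr.
  by move=> u c v1 v2; rewrite ract_linearr lact_linearr.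
by apply: eq_bigr => j _; rewrite ractM lractA.
Qed.

(* Half of Higman's criterion: th is a section of coind_eval followed by the
   evaluation at (1, 1). *)
Lemma projective_transfer : projective P ->
  exists th : P -> P, linear th /\ forall x, transfer e f th x = x.
Proof.
move=> Pproj.
pose ev := mk_bimod_hom coind_eval_linear coind_eval_lact coind_eval_ract.
have [|s sP] := Pproj (coinduced P) P ev (id_hom P).
  move=> x.
  (* The family corresponding to 1 (x) x (x) 1, which the action map sends to x. *)
  pose F : bimod_prod (fun _ : A * A => P) :=
    fun uv => lam uv.1 *: (lam uv.2 *: x).
  have FB : F \in @bilinear_fam k A P.
    have lamE c u v : lam (c *: u + v) = c * lam u + lam v.
      exact: (lam_linear ef).
    apply/asboolP; split=> [v|u] c u1 u2; rewrite /F /=.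
      by rewrite lamE scalerDl !scalerA mulrA.
    rewrite lamE scalerDl scalerDr !scalerA.
    by rewrite [lam u * (c * _)]mulrCA mulrA.
  exists (exist (fun G => G \in @bilinear_fam k A P) F FB); rewrite /= /coind_eval /=.
  rewrite -[RHS]lact1 -[in RHS](dual_unit_e ef) lact_suml; apply: eq_bigr => i _.
  rewrite -[in RHS](ract1 x) -(dual_unit_f ef) ract_sumr lact_sumr.
  by apply: eq_bigr => j _; rewrite lactZl ractZr !ractZl !lactZr.
exists (fun x => val (s x) (1, 1)); split=> [c x y|x].
  by rewrite linearP; exact: coind_valD.
(* As [s] is a bimodule map, its value at [f i] x [e j], evaluated at (1, 1), is [s x] evaluated at
   [(f i, e j)]. *)
rewrite -[RHS](sP x) transferE; apply: eq_bigr => i _; apply: eq_bigr => j _.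
by rewrite hom_ract hom_lact /= mul1r mulr1.
Qed.

End Higman.

(** * Lifting and extension by averaging *)

Section Lifting.
Context (k : fieldType) (A : algType k) (n : nat) (lam : A -> k).
Context (e f : 'I_n -> A) (ef : dual_bases lam e f).
Implicit Types M N P : bimodType A.

(** The [e i] span A over k, so the products [e i] g [e j], with g a generator, span M. *)
Lemma fin_generated_spanned M : fin_generated M -> finitely_spanned M.
Proof.
move=> [s sP].
pose J : finType := ('I_n * 'I_(size s) * 'I_n)%type.
pose t (i : J) := lact (e i.1.1) (ract s`_i.1.2 (e i.2)).
pose spanned x := exists a : J -> k, x = \sum_i a i *: t i.
have spannedD x y : spanned x -> spanned y -> spanned (x + y).
  move=> [a ->] [b ->]; exists (fun i => a i + b i); rewrite -big_split.
  by apply: eq_bigr => i _; rewrite scalerDl.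
have spanned0 : spanned 0.
  by exists (fun=> 0); rewrite big1 // => i _; rewrite scale0r.
have spannedZ c x : spanned x -> spanned (c *: x).
  move=> [a ->]; exists (fun i => c * a i); rewrite scaler_sumr.
  by apply: eq_bigr => i _; rewrite scalerA.
have spanned_sum (I : finType) (F : I -> M) :
    (forall i, spanned (F i)) -> spanned (\sum_i F i).
  by move=> FS; elim/big_ind: _.
have spanned_gen a g b : g \in s -> spanned (lact a (ract g b)).
  move=> gs; have lt_g : (index g s < size s)%N by rewrite index_mem.
  rewrite -[a](sum_dual_e ef) lact_suml; apply: (spanned_sum) => i.
  rewrite lactZl -[b](sum_dual_e ef) ract_sumr lact_sumr; apply: (spannedZ).
  apply: (spanned_sum) => j; rewrite ractZr lactZr; apply: (spannedZ).
  exists (fun u => (u == (i, Ordinal lt_g, j))%:R).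
  rewrite (bigD1 (i, Ordinal lt_g, j)) //= eqxx scale1r big1 => [|u /negPf->].
    by rewrite addr0 /t /= nth_index.
  by rewrite scale0r.
exists #|J|, (fun i => t (enum_val i)) => x.
have [a ->] : spanned x.
  have [r [rs ->]] := sP x; elim: r rs => [|u r IHr] rs; first by rewrite big_nil.
  rewrite big_cons; apply: spannedD.
    by apply: spanned_gen; apply: rs; rewrite mem_head.
  by apply: IHr => y yr; apply: rs; rewrite inE yr orbT.
exists (fun i => a (enum_val i)).
by rewrite (reindex_onto enum_val enum_rank) //= => [|i _];
  [apply: eq_bigl => i; rewrite enum_valK eqxx | rewrite enum_rankK].
Qed.

Definition right_linear M N (w : M -> N) : Prop :=
  linear w /\ forall x a, w (ract x a) = ract (w x) a.

(** Average the k-linear lift composed with [th]: both [g] and [w] pass through the sum, which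
    leaves the average of [th], the identity. *)
Lemma right_linear_lift M N P (th : P -> P) (g : bimod_hom M N) (w : P -> N)
    (L : N -> M) : linear th -> rtransfer e f th =1 id -> right_linear w ->
  linear L -> (forall x, g (L (w x)) = w x) ->
  exists h : P -> M, right_linear h /\ forall x, g (h x) = w x.
Proof.
move=> thL thE [wL wr] LL gL; exists (rtransfer e f (L \o w \o th)).
have cL : linear (L \o w \o th) by move=> c x y /=; rewrite thL wL LL.
split; first by split=> [|x a]; [exact: rtransfer_linear | exact: (rtransfer_ract ef)].
move=> x; rewrite /rtransfer linear_sum -[in RHS](thE x) /rtransfer (lin_sum wL).
by apply: eq_bigr => i _ /=; rewrite hom_ract gL wr.
Qed.

(** Here the target carries [th]. This is how projectivity yields extensions: over a Frobenius
    algebra projective modules are injective. *)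
Lemma right_linear_extend M N P (th : P -> P) (d : bimod_hom M N) (u : M -> P)
    (v : N -> P) : linear th -> rtransfer e f th =1 id -> right_linear u ->
  linear v -> (forall x, v (d x) = u x) ->
  exists h : N -> P, right_linear h /\ forall x, h (d x) = u x.
Proof.
move=> thL thE [uL ur] vL vd; exists (rtransfer e f (th \o v)).
have cL : linear (th \o v) by move=> c x y /=; rewrite vL thL.
split; first by split=> [|x a]; [exact: rtransfer_linear | exact: (rtransfer_ract ef)].
move=> x; rewrite -[RHS]thE; apply: eq_bigr => i _ /=.
by rewrite -hom_ract vd ur.
Qed.

Lemma hom_lift M N P (th : P -> P) (g : bimod_hom M N) (w : bimod_hom P N)
    (L : N -> M) : linear th -> transfer e f th =1 id ->
  linear L -> (forall x, g (L (w x)) = w x) ->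
  exists h : bimod_hom P M, forall x, g (h x) = w x.
Proof.
move=> thL thE LL gL.
have cL : linear (L \o w \o th) by move=> c x y /=; rewrite thL linearP LL.
exists (transfer_hom ef cL) => x; rewrite /= transfer_post.
rewrite -[in RHS](thE x) transfer_post; apply: eq_transfer => y /=; exact: gL.
Qed.

Lemma hom_extend M N P (th : P -> P) (d : bimod_hom M N) (u : bimod_hom M P)
    (v : N -> P) : linear th -> transfer e f th =1 id ->
  linear v -> (forall x, v (d x) = u x) ->
  exists h : bimod_hom N P, forall x, h (d x) = u x.
Proof.
move=> thL thE vL vd.
have cL : linear (th \o v) by move=> c x y /=; rewrite vL thL.
exists (transfer_hom ef cL) => x; rewrite /= transfer_pre.
by rewrite -[RHS]thE transfer_pre; apply: eq_transfer => y /=; rewrite vd.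
Qed.

End Lifting.

(** * Contraction of T over right A-modules *)

Section Contraction.
Context (k : fieldType) (A : algType k) (n : nat) (lam : A -> k).
Context (e f : 'I_n -> A) (ef : dual_bases lam e f).
Context (T : complex A) (eps : bimod_hom (T 0) (regular_bimod A)).
Context (hT : complete_resolution eps).

Lemma resolution_transfer i :
  exists th : T i -> T i, linear th /\ transfer e f th =1 id.
Proof.
by case: hT => _ /(_ i)[_ Tp] _ _; have := projective_transfer ef Tp.
Qed.

(** Averaging on the left only gives a left A-linear map whose right average is the identity. Left
    linearity later makes the contractions of T_p (x) T bimodule maps. *)
Lemma resolution_rtransfer i :
  exists th : T i -> T i, [/\ linear th, forall a x, th (lact a x) = lact a (th x)
    & rtransfer e f th =1 id].
Proof.
have [th [thL thE]] := resolution_transfer i.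
exists (ltransfer e f th); split=> [|a x|x]; first exact: ltransfer_linear.
  exact: (ltransfer_lact ef).
rewrite -[RHS]thE transferE exchange_big; apply: eq_bigr => j _ /=.
rewrite /ltransfer ract_suml; apply: eq_bigr => l _.
by rewrite !lractA.
Qed.

Lemma resolution_ltransfer i :
  exists th : T i -> T i, [/\ linear th, forall x a, th (ract x a) = ract (th x) a
    & ltransfer e f th =1 id].
Proof.
have [th [thL thE]] := resolution_transfer i.
exists (rtransfer e f th); split=> [|x a|x]; first exact: rtransfer_linear.
  exact: (rtransfer_ract ef).
by rewrite -[RHS]thE.
Qed.

(** Generalized inverses of the differentials; by acyclicity a cycle is a boundary, and so is
    recovered from its image under [c]. *)
Lemma linear_splitting : exists c : forall i, T i -> T (i + 1),
  [/\ forall i, linear (c i),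
      forall i x, diff T i (c i (diff T i x)) = diff T i x &
      forall i (x : T (i + 1)), diff T i x = 0 -> diff T (i + 1) (c (i + 1) x) = x].
Proof.
case: hT => Tex Tfg _ _.
have Tf i : finitely_spanned (T i).
  by apply: (fin_generated_spanned ef); case: (Tfg i).
have cE i : exists c : T i -> T (i + 1),
    linear c /\ forall x, diff T i (c (diff T i x)) = diff T i x.
  by apply: generalized_inverse; [exact: hom_linear | exact: Tf | exact: Tf].
exists (fun i => projT1 (cid (cE i))).
split=> [i|i|i x /Tex[y <-]]; case: cid => c [] //=.
Qed.

(** The contraction identity in one degree involves only two consecutive maps, which makes it a
    relation fit for [int_chain]. *)
Definition partial_contraction i (w : T i -> T (i + 1))
    (w' : T (i + 1) -> T (i + 1 + 1)) : Prop :=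
  [/\ right_linear w, right_linear w' &
      forall x, diff T (i + 1) (w' x) + w (diff T i x) = x].

(** The hypothesis makes [x - w (diff T i x)] a cycle, so it lifts through the next differential. *)
Lemma contraction_up i (w : T i -> T (i + 1)) : right_linear w ->
  (forall x, diff T i (w (diff T i x)) = diff T i x) ->
  exists w', partial_contraction w w'.
Proof.
move=> wR dwd; have [c [cL cd cK]] := linear_splitting.
have [th [thL _ thE]] := resolution_rtransfer (i + 1).
pose p x := x - w (diff T i x).
have pR : right_linear p.
  case: wR => wL wr; split=> [a x y|x a]; rewrite /p.
    by rewrite linearP wL scalerBr opprD addrACA.
  by rewrite hom_ract wr ractBl.
have [||w' [w'R dw']] := @right_linear_lift _ _ _ _ _ _ ef _ _ _ th
    (diff T (i + 1)) p (c (i + 1)) thL thE pR; first exact: cL.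
  by move=> x; apply: cK; rewrite /p linearB dwd subrr.
by exists w'; split=> // x; rewrite dw' subrK.
Qed.

(** Since d_0 = eta eps, it suffices to compose a right A-linear retraction of eta with a right
    A-linear section of eps. *)
Lemma contraction_base : exists w : T (-1) -> T (-1 + 1), right_linear w /\
  forall x, diff T (-1) (w (diff T (-1) x)) = diff T (-1) x.
Proof.
case: (hT) => _ _ eps_surj [eta [eta_inj eta_eps]].
have [c [cL cd _]] := linear_splitting.
have lamL := lam_linear ef.
have [x0 x0E] := eps_surj 1.
pose kap (t : T (-1)) : regular_bimod A := eps (c (-1) t).
have kapL : linear kap by move=> a x y; rewrite /kap cL linearP.
have kapE a : kap (eta a) = a.
  have [x <-] := eps_surj a; apply: eta_inj.
  have := cd (-1) x; rewrite !eta_eps; exact.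
(* The right A-linear map to A whose composite with [lam] is [lam] after [kap]; it retracts eta
   because [kap] does. *)
pose rho (t : T (-1)) : A := \sum_i lam (kap (ract t (e i))) *: f i.
have rhoL : linear rho.
  move=> a x y; rewrite /rho scaler_sumr -big_split; apply: eq_bigr => i _ /=.
  rewrite ract_linearl kapL scalerA.
  by rewrite (lamL a (kap (ract x (e i))) (kap (ract y (e i)))) scalerDl.
have rho_ract x a : rho (ract x a) = rho x * a.
  rewrite /rho mulr_suml.
  transitivity (\sum_i lam (kap (ract x (a * e i))) *: f i).
    by apply: eq_bigr => i _; rewrite ractM.
  rewrite (casimir ef (B := fun u v => lam (kap (ract x u)) *: v)).
  - by apply: eq_bigr => i _; rewrite scalerAl.
  - move=> v b u u'; rewrite ract_linearr kapL scalerA.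
    by rewrite (lamL b (kap (ract x u)) (kap (ract x u'))) scalerDl.
  - by move=> u b v v'; rewrite scalerDr !scalerA mulrC.
have rho_eta a : rho (eta a) = a.
  rewrite -[RHS](sum_dual_f ef); apply: eq_bigr => i _.
  by rewrite -hom_ract kapE.
(* A is free on 1 as a right module, so [x0] determines a section of eps. *)
exists (fun t => ract (x0 : T (-1 + 1)) (rho t)); split; first split.
- by move=> a x y; rewrite rhoL ract_linearr.
- by move=> x a; rewrite rho_ract ractM.
- move=> x; rewrite !eta_eps rho_eta; congr (eta _).
  by rewrite [eps _]hom_ract x0E; exact: mul1r.
Qed.

(** From the base, [contraction_up] goes up and extension goes down. Only right linearity is sought:
    a contraction by bimodule maps would make A a projective bimodule. *)
Lemma right_contraction : exists s : forall i, T i -> T (i + 1),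
  (forall i, right_linear (s i)) /\
  forall i x, diff T (i + 1) (s (i + 1) x) + s i (diff T i x) = x.
Proof.
have [w0 [w0R w0E]] := contraction_base.
have [w1 w01] := contraction_up w0R w0E.
have [||s [_ sP]] := int_chain (R := partial_contraction) w01.
- move=> i w w' [wR w'R ww']; apply: contraction_up => // x.
  have := ww' (diff T (i + 1) x).
  by rewrite diff_diff (lin0 (proj1 wR)) addr0.
- move=> i w' w'' [w'R w''R ww'].
  have [c [cL cd cK]] := linear_splitting.
  have [th [thL _ thE]] := resolution_rtransfer (i + 1).
  (* [u] vanishes on boundaries, hence extends along the differential to the next lower map of the
     contraction. *)
  pose u x := x - diff T (i + 1) (w' x).
  have uR : right_linear u.
    case: w'R => w'L w'r; split=> [a x y|x a]; rewrite /u.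
      by rewrite w'L linearP scalerBr opprD addrACA.
    by rewrite w'r hom_ract ractBl.
  have ud x : u (diff T (i + 1) x) = 0.
    rewrite /u -{1}(ww' x) linearD diff_diff add0r.
    exact: subrr.
  have [||w [wR wd]] := @right_linear_extend _ _ _ _ _ _ ef _ _ _ th
      (diff T i) u (u \o c i) thL thE uR.
  + by move=> a x y /=; rewrite cL (proj1 uR).
  + move=> x /=; apply/esym/eqP; rewrite -subr_eq0 -(linB (proj1 uR)).
    by rewrite -[x - _]cK ?ud // linearB cd subrr.
  by exists w; split=> // x; rewrite wd [_ + u x]addrC subrK.
by exists s; split=> i; case: (sP i).
Qed.

End Contraction.

(** * Composites and combinations of bimodule maps *)

Section HomAlgebra.
Context (k : fieldType) (A : algType k).
Implicit Types M N P : bimodType A.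

Lemma homZ M N (f : bimod_hom M N) c x : f (c *: x) = c *: f x.
Proof. exact: linearZ_LR. Qed.

Lemma homD M N (f : bimod_hom M N) x y : f (x + y) = f x + f y.
Proof. exact: linearD. Qed.

Lemma homB M N (f : bimod_hom M N) x y : f (x - y) = f x - f y.
Proof. exact: linearB. Qed.

Lemma hom0 M N (f : bimod_hom M N) : f 0 = 0.
Proof. exact: linear0. Qed.

Fact comp_hom_linear M N P (g : bimod_hom N P) (f : bimod_hom M N) : linear (g \o f).
Proof. by move=> c x y /=; rewrite !linearP. Qed.

Fact comp_hom_lact M N P (g : bimod_hom N P) (f : bimod_hom M N) a x :
  (g \o f) (lact a x) = lact a ((g \o f) x).
Proof. by rewrite /= !hom_lact. Qed.

Fact comp_hom_ract M N P (g : bimod_hom N P) (f : bimod_hom M N) x a :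
  (g \o f) (ract x a) = ract ((g \o f) x) a.
Proof. by rewrite /= !hom_ract. Qed.

Definition comp_hom M N P (g : bimod_hom N P) (f : bimod_hom M N) : bimod_hom M P :=
  mk_bimod_hom (comp_hom_linear g f) (comp_hom_lact g f) (comp_hom_ract g f).

Fact comb_hom_lact M N c (f g : bimod_hom M N) a x :
  c *: f (lact a x) + g (lact a x) = lact a (c *: f x + g x).
Proof. by rewrite !hom_lact lact_linearr. Qed.

Fact comb_hom_ract M N c (f g : bimod_hom M N) x a :
  c *: f (ract x a) + g (ract x a) = ract (c *: f x + g x) a.
Proof. by rewrite !hom_ract ract_linearl. Qed.

Definition comb_hom M N c (f g : bimod_hom M N) : bimod_hom M N :=
  mk_bimod_hom (linear_comb c (hom_linear f) (hom_linear g)) (comb_hom_lact c f g)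
    (comb_hom_ract c f g).

Lemma comb_homN M N (f g : bimod_hom M N) x : comb_hom (-1) f g x = g x - f x.
Proof. by rewrite /= scaleN1r addrC. Qed.

Fact zero_hom_linear M N : linear (fun _ : M => 0 : N).
Proof. by move=> c x y; rewrite scaler0 addr0. Qed.

Definition zero_hom M N : bimod_hom M N :=
  mk_bimod_hom (@zero_hom_linear M N) (fun a _ => esym (lact0 N a))
    (fun _ a => esym (ract0 N a)).

Lemma zero_homE M N x : zero_hom M N x = 0.
Proof. by []. Qed.

End HomAlgebra.

(** * Contractions of the tensor products T_p (x) T_q *)

Section TensorTransfer.
Context (k : fieldType) (A : algType k) (n : nat) (lam : A -> k).
Context (e f : 'I_n -> A) (ef : dual_bases lam e f).
Context (M M' N N' : bimodType A) (u : M -> M') (v : N -> N').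
Context (uL : linear u) (vL : linear v).

(** A substitute for u (x) v when both maps are only k-linear: inserting the Casimir element makes
    the formula balanced. *)
Definition tens_transfer : tens M N -> tens M' N' :=
  tens_lift (fun x y => \sum_i tmul (u (ract x (e i))) (v (lact (f i) y))).

Fact tens_transfer_balanced :
  balanced (fun x y => \sum_i tmul (u (ract x (e i))) (v (lact (f i) y))).
Proof.
split=> [y c x x'|x c y y'|x a y].
- rewrite scaler_sumr -big_split; apply: eq_bigr => i _ /=.
  by rewrite ract_linearl uL tmulDl tmulZl.
- rewrite scaler_sumr -big_split; apply: eq_bigr => i _ /=.
  by rewrite lact_linearr vL tmulDr tmulZr.
- under eq_bigr do rewrite -ractM.
  under [RHS]eq_bigr do rewrite -lactM.
  apply: (casimir ef (B := fun b c => tmul (u (ract x b)) (v (lact c y)))).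
    by move=> b c b' b''; rewrite ract_linearr uL tmulDl tmulZl.
  by move=> b c b' b''; rewrite lact_linearl vL tmulDr tmulZr.
Qed.

Lemma tens_transfer_tmul x y :
  tens_transfer (tmul x y) = \sum_i tmul (u (ract x (e i))) (v (lact (f i) y)).
Proof. exact/tens_lift_tmul/tens_transfer_balanced. Qed.

Lemma tens_transfer_linear : linear tens_transfer.
Proof. exact/tens_lift_is_linear/tens_transfer_balanced. Qed.

Lemma tens_transfer_lact a t : (forall x, u (lact a x) = lact a (u x)) ->
  tens_transfer (lact a t) = lact a (tens_transfer t).
Proof.
move=> ul; move: t; apply: tens_eq_linear.
- by move=> c s t; rewrite lact_linearr tens_transfer_linear.
- by move=> c s t; rewrite tens_transfer_linear lact_linearr.
move=> x y; rewrite [lact a (tmul x y)]tens_lact_tmul !tens_transfer_tmul lact_sumr.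
apply: eq_bigr => i _.
by rewrite [RHS]tens_lact_tmul lractA ul.
Qed.

Lemma tens_transfer_ract t a : (forall y, v (ract y a) = ract (v y) a) ->
  tens_transfer (ract t a) = ract (tens_transfer t) a.
Proof.
move=> vr; move: t; apply: tens_eq_linear.
- by move=> c s t; rewrite ract_linearl tens_transfer_linear.
- by move=> c s t; rewrite tens_transfer_linear ract_linearl.
move=> x y; rewrite [ract (tmul x y) a]tens_ract_tmul !tens_transfer_tmul ract_suml.
apply: eq_bigr => i _.
by rewrite [RHS]tens_ract_tmul -lractA vr.
Qed.

End TensorTransfer.

Section TensorSums.
Context (k : fieldType) (A : algType k) (M N : bimodType A).

Lemma tmul_suml I (r : seq I) (x : I -> M) (y : N) :
  tmul (\sum_(i <- r) x i) y = \sum_(i <- r) tmul (x i) y.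
Proof. by elim/big_rec2: _ => [|i a b _ <-]; rewrite ?tmul0l ?tmulDl. Qed.

Lemma tmul_sumr I (r : seq I) (x : M) (y : I -> N) :
  tmul x (\sum_(i <- r) y i) = \sum_(i <- r) tmul x (y i).
Proof. by elim/big_rec2: _ => [|i a b _ <-]; rewrite ?tmul0r ?tmulDr. Qed.

End TensorSums.

Section TensorDifferentials.
Context (k : fieldType) (A : algType k) (T : complex A).

Definition tens_diffl p q : bimod_hom (tens (T (p + 1)) (T q)) (tens (T p) (T q)) :=
  tens_map (diff T p) (id_hom (T q)).
Definition tens_diffr p q : bimod_hom (tens (T p) (T (q + 1))) (tens (T p) (T q)) :=
  tens_map (id_hom (T p)) (diff T q).

Lemma tens_diffl_tmul p q x y : tens_diffl p q (tmul x y) = tmul (diff T p x) y.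
Proof. exact: tens_map_tmul. Qed.

Lemma tens_diffr_tmul p q x y : tens_diffr p q (tmul x y) = tmul x (diff T q y).
Proof. exact: tens_map_tmul. Qed.

Lemma tens_difflK p q t : tens_diffl p q (tens_diffl (p + 1) q t) = 0.
Proof.
apply: (tens_map_comp (h := fun=> 0)) => [|x y]; first exact: zero_hom_linear.
by rewrite diff_diff tmul0l.
Qed.

Lemma tens_diffrK p q t : tens_diffr p q (tens_diffr p (q + 1) t) = 0.
Proof.
apply: (tens_map_comp (h := fun=> 0)) => [|x y]; first exact: zero_hom_linear.
by rewrite diff_diff tmul0r.
Qed.

Lemma tens_difflr p q t :
  tens_diffl p q (tens_diffr (p + 1) q t) = tens_diffr p q (tens_diffl p (q + 1) t).
Proof.
apply: (tens_map_comp (h := tens_diffr p q \o tens_diffl p (q + 1))) => [|x y].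
  exact: comp_hom_linear.
by rewrite /= tens_diffl_tmul tens_diffr_tmul.
Qed.

End TensorDifferentials.

Section TensorContractions.
Context (k : fieldType) (A : algType k) (n : nat) (lam : A -> k).
Context (e f : 'I_n -> A) (ef : dual_bases lam e f).
Context (T : complex A) (eps : bimod_hom (T 0) (regular_bimod A)).
Context (hT : complete_resolution eps).

(** The contraction [s] acts on the left factor, and averaging [th] restores the right one. As [s]
    need not be left linear, [L] is only claimed k-linear, which suffices for lifting maps out of a
    projective bimodule. *)
Lemma tens_diffl_exact p q :
  exists L : tens (T (p + 1)) (T q) -> tens (T (p + 1 + 1)) (T q),
    linear L /\ forall t, tens_diffl T p q t = 0 -> tens_diffl T (p + 1) q (L t) = t.
Proof.
have [s [sR sE]] := right_contraction ef hT.
have [th [thL _ thE]] := resolution_ltransfer ef hT q.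
have sL i : linear (s i) by case: (sR i).
pose L i := tens_transfer e f (s i) th.
have LL i : linear (L i) by apply: (tens_transfer_linear ef).
exists (L (p + 1)); split=> // t dt.
suff E u : tens_diffl T (p + 1) q (L (p + 1) u) + L p (tens_diffl T p q u) = u.
  by rewrite -[RHS]E dt (lin0 (LL p)) addr0.
move: u; apply: tens_eq_linear => [c u v|//|x y].
  by rewrite LL !linearP LL scalerDr addrACA.
rewrite tens_diffl_tmul /L !(tens_transfer_tmul ef) // linear_sum -big_split /=.
rewrite -[in RHS](thE y) tmul_sumr; apply: eq_bigr => i _.
by rewrite tens_diffl_tmul -hom_ract -tmulDl sE tmulA.
Qed.

(** [s] need not be left linear, so 1 (x) s may fail to be balanced; the Casimir element repairs
    this. Left linearity of [th] and right linearity of [s] make the result a bimodule map. *)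
Lemma tens_diffr_contraction p :
  exists H : forall q, bimod_hom (tens (T p) (T q)) (tens (T p) (T (q + 1))),
    forall q t, tens_diffr T p (q + 1) (H (q + 1) t) + H q (tens_diffr T p q t) = t.
Proof.
have [s [sR sE]] := right_contraction ef hT.
have [th [thL thl thE]] := resolution_rtransfer ef hT p.
have sL i : linear (s i) by case: (sR i).
exists (fun q => mk_bimod_hom (tens_transfer_linear ef thL (sL q))
  (fun a t => tens_transfer_lact ef thL (sL q) t (thl a))
  (fun t a => tens_transfer_ract ef thL (sL q) t (fun y => proj2 (sR q) y a))) => q.
set H := mk_bimod_hom _ _ _; set H' := mk_bimod_hom _ _ _.
apply: tens_eq_linear => [c u v|//|x y].
  by rewrite !linearP scalerDr addrACA.
rewrite tens_diffr_tmul /H /H' /= !(tens_transfer_tmul ef) // linear_sum -big_split /=.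
rewrite -[in RHS](thE x) tmul_suml; apply: eq_bigr => i _.
by rewrite tens_diffr_tmul -hom_lact -tmulDr sE tmulA.
Qed.

Section Augmentation.
Context (q : int).

Fact eps_tens_balanced : balanced (fun (x : T 0) (y : T q) => lact (eps x : A) y).
Proof.
split=> [y c x x'|x|x a y]; first by rewrite linearP lact_linearl.
  exact: lact_linearr.
by rewrite hom_ract -lactM.
Qed.

(** This is eps (x) 1 followed by the identification of A (x)_A T_q with T_q. *)
Definition eps_tens_fun : tens (T 0) (T q) -> T q :=
  tens_lift (fun x y => lact (eps x : A) y).

Lemma eps_tens_fun_tmul x y : eps_tens_fun (tmul x y) = lact (eps x : A) y.
Proof. exact/tens_lift_tmul/eps_tens_balanced. Qed.

Fact eps_tens_fun_linear : linear eps_tens_fun.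
Proof. exact/tens_lift_is_linear/eps_tens_balanced. Qed.

Fact eps_tens_fun_lact a t : eps_tens_fun (lact a t) = lact a (eps_tens_fun t).
Proof.
move: t; apply: tens_eq_linear => [c s t|c s t|x y].
- by rewrite lact_linearr eps_tens_fun_linear.
- by rewrite eps_tens_fun_linear lact_linearr.
- by rewrite [lact a (tmul x y)]tens_lact_tmul !eps_tens_fun_tmul hom_lact -lactM.
Qed.

Fact eps_tens_fun_ract t a : eps_tens_fun (ract t a) = ract (eps_tens_fun t) a.
Proof.
move: t; apply: tens_eq_linear => [c s t|c s t|x y].
- by rewrite ract_linearl eps_tens_fun_linear.
- by rewrite eps_tens_fun_linear ract_linearl.
- by rewrite [ract (tmul x y) a]tens_ract_tmul !eps_tens_fun_tmul lractA.
Qed.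

Definition eps_tens : bimod_hom (tens (T 0) (T q)) (T q) :=
  mk_bimod_hom eps_tens_fun_linear eps_tens_fun_lact eps_tens_fun_ract.

Lemma eps_tens_tmul x y : eps_tens (tmul x y) = lact (eps x : A) y.
Proof. exact: eps_tens_fun_tmul. Qed.

Lemma eps_tens_section : exists S : bimod_hom (T q) (tens (T 0) (T q)),
  forall y, eps_tens (S y) = y.
Proof.
case: hT => _ /(_ q)[_ Tq] eps_surj _; apply: (Tq _ _ eps_tens (id_hom _)) => y.
have [x0 x0E] := eps_surj 1; exists (tmul x0 y).
by rewrite eps_tens_tmul x0E lact1.
Qed.

(** [eta] is injective, and eta eps d is a composite of two differentials. *)
Lemma eps_tens_diffl (t : tens (T (0 + 1)) (T q)) : eps_tens (tens_diffl T 0 q t) = 0.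
Proof.
move: t; apply: tens_eq_linear => [|c s t|x y].
- exact: comp_hom_linear.
- by rewrite scaler0 addr0.
rewrite tens_diffl_tmul eps_tens_tmul; suff -> : eps (diff T 0 x) = 0.
  by rewrite -(scale0r (0 : A)) lactZl scale0r.
case: hT => _ _ _ [eta [eta_inj etaE]]; apply: eta_inj.
by rewrite linear0 -etaE; exact: (@diff_diff _ _ T (-1)).
Qed.

(** As d_0 = eta eps, the map d_0 (x) 1 factors through eps (x) 1. This turns a condition on eps (x)
    1 into the cycle condition needed to build column 1. *)
Lemma tens_diffl_eps_eq0 (t : tens (T 0) (T q)) :
  eps_tens t = 0 -> tens_diffl T (-1) q t = 0.
Proof.
case: hT => _ _ _ [eta [_ etaE]] t0.
suff E s : tens_diffl T (-1) q s = tmul (eta 1) (eps_tens s) by rewrite E t0 tmul0r.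
move: s; apply: tens_eq_linear => [c s t'|c s t'|x y].
- by rewrite linearP.
- by rewrite linearP tmulDr tmulZr.
rewrite tens_diffl_tmul eps_tens_tmul -tmulA -hom_ract; congr (tmul _ y).
by rewrite etaE; congr (eta _); exact/esym/mul1r.
Qed.

End Augmentation.

Lemma eps_tens_diffr q t :
  eps_tens q (tens_diffr T 0 q t) = diff T q (eps_tens (q + 1) t).
Proof.
move: t; apply: tens_eq_linear => [||x y]; try exact: comp_hom_linear.
by rewrite tens_diffr_tmul !eps_tens_tmul hom_lact.
Qed.

(** The augmentation of the complete tensor product is thereby read off from eps (x) 1 on column
    0. *)
Lemma tens_unit_eps t : tens_unit (tens_map eps eps t) = eps (eps_tens 0 t).
Proof.
have unitL : linear (@tens_unit k A : _ -> regular_bimod A).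
  apply: tens_lift_is_linear; split=> [z|z|u a v].
  - exact: regular_mul_linearl.
  - exact: regular_mul_linearr.
  - exact/esym/mulrA.
move: t; apply: tens_eq_linear (regular_bimod A) _ _ _ _ _ => [c s t|c s t|x y].
- by rewrite linearP unitL.
- by rewrite !linearP.
rewrite eps_tens_tmul hom_lact [tens_map eps eps _]tens_map_tmul.
exact: (tens_unit_tmul (eps x) (eps y)).
Qed.

End TensorContractions.

(** * Solving the equations between columns *)

Section TensorSystem.
Context (k : fieldType) (A : algType k) (m : nat) (lam : A -> k).
Context (e f : 'I_m -> A) (ef : dual_bases lam e f).
Context (T : complex A) (eps : bimod_hom (T 0) (regular_bimod A)).
Context (hT : complete_resolution eps) (c : k) (delta : int).

Local Notation sg p := ((-1 : k) ^ p).

Lemma sgS (p : int) : sg (p + 1) = - sg p.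
Proof. by rewrite expfzDr ?oppr_eq0 ?oner_eq0 // expr1z mulrN1. Qed.

Lemma sgK (p : int) : sg p * sg p = 1.
Proof. by rewrite -expfzMl mulrNN mulr1 exp1rz. Qed.

Lemma sum_succl (p q n : int) : p + q == n + delta -> p + 1 + q == n + 1 + delta.
Proof. by move=> /eqP pq; rewrite addrAC pq addrAC. Qed.

Context (E : forall p q n : int,
  p + q == n + delta -> bimod_hom (T (n + 1)) (tens (T p) (T q))).

(** The compatibility that the total differential, applied to the equations of [column_eq], forces
    on [E]. *)
Hypothesis E_cycle : forall p q n (pq : p + q == n + delta)
    (pq1 : p + 1 + q == n + 1 + delta) (pq2 : p + (q + 1) == n + 1 + delta)
    (x : T (n + 1 + 1)),
  tens_diffl T p q (E pq1 x) + sg p *: tens_diffr T p q (E pq2 x)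
  = c *: E pq (diff T (n + 1) x).

(** The indices [q] and [n] are independent arguments tied by a proof, so that shifting them
    requires no transport. *)
Definition column p := forall q n : int,
  p + q == n + delta -> bimod_hom (T n) (tens (T p) (T q)).

(* For [c = -1], [delta = 0], [E = 0] this says that the columns form a chain map
   from T to the complete tensor product, and for [c = 1], [delta = 1] that they
   form a homotopy whose boundary is E. *)
Definition column_eq p (F : column p) (F' : column (p + 1)) : Prop :=
  forall q n (pq : p + q == n + delta) (pq1 : p + 1 + q == n + 1 + delta)
      (pq2 : p + (q + 1) == n + 1 + delta) (x : T (n + 1)),
    E pq x = tens_diffl T p q (F' _ _ pq1 x) + sg p *: tens_diffr T p q (F _ _ pq2 x)
             + c *: F _ _ pq (diff T n x).

(* What [tens_diffl] must hit in order to continue F to the column p + 1. *)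
Definition defect p (F : column p) q n (pq : p + q == n + delta)
    (pq2 : p + (q + 1) == n + 1 + delta) :
    bimod_hom (T (n + 1)) (tens (T p) (T q)) :=
  comb_hom (- c) (comp_hom (F _ _ pq) (diff T n))
    (comb_hom (- sg p) (comp_hom (tens_diffr T p q) (F _ _ pq2)) (E pq)).

Lemma defectE p (F : column p) q n (pq : p + q == n + delta)
    (pq2 : p + (q + 1) == n + 1 + delta) x : defect F pq pq2 x =
  E pq x - sg p *: tens_diffr T p q (F _ _ pq2 x) - c *: F _ _ pq (diff T n x).
Proof. by rewrite /= !scaleNr addrC [- _ + E _ _]addrC. Qed.

(** Each component of the defect is a cycle of T (x) T_q, so exactness there and projectivity of
    T_(n+1) lift it. *)
Lemma column_succ p (F : column (p + 1)) :
  (forall q n (pq : p + 1 + q == n + delta)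
     (pq2 : p + 1 + (q + 1) == n + 1 + delta) x,
   tens_diffl T p q (defect F pq pq2 x) = 0) ->
  exists F', column_eq F F'.
Proof.
move=> dF.
have G q n : exists h : bimod_hom (T (n + 1)) (tens (T (p + 1 + 1)) (T q)),
    forall (pq : p + 1 + q == n + delta) (pq2 : p + 1 + (q + 1) == n + 1 + delta) x,
    tens_diffl T (p + 1) q (h x) = defect F pq pq2 x.
  have [pq|npq] := pselect (p + 1 + q == n + delta); last first.
    by exists (zero_hom _ _) => pq; case: npq.
  have pq2 : p + 1 + (q + 1) == n + 1 + delta.
    by rewrite addrA (eqP pq) addrAC.
  have [L [LL dL]] := tens_diffl_exact ef hT p q.
  have [th [thL thE]] := resolution_transfer ef hT (n + 1).
  have [x|h hE] := hom_lift ef (g := tens_diffl T (p + 1) q)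
      (w := defect F pq pq2) thL thE LL.
    by apply: dL; apply: dF.
  exists h => pq' pq2' x.
  by rewrite (bool_irrelevance pq' pq) (bool_irrelevance pq2' pq2).
(* The lifts start at degrees written [n + 1]; [int_shift] reindexes them by all [n]. *)
have S q : exists F' : forall n : int, p + 1 + 1 + q == n + delta ->
    bimod_hom (T n) (tens (T (p + 1 + 1)) (T q)),
    forall n, F' (n + 1) = fun=> projT1 (cid (G q n)).
  exact: (int_shift (X := fun n => p + 1 + 1 + q == n + delta ->
    bimod_hom (T n) (tens (T (p + 1 + 1)) (T q)))).
exists (fun q => projT1 (cid (S q))) => q n pq pq1 pq2 x.
case: cid => F' /= ->.
by rewrite (projT2 (cid (G q n)) pq pq2) defectE addrAC subrK subrK.
Qed.

(** The defect of [F'] is a cycle: the previous equation and [E_cycle] cancel, since d (x) 1 and 1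
    (x) d commute while the sign changes from p to p + 1. *)
Lemma column_next p (F : column p) (F' : column (p + 1)) :
  column_eq F F' -> exists F'', column_eq F' F''.
Proof.
(* Writing [n] as a successor makes the equation between [F] and [F'] available one degree lower. *)
move=> FF'; apply: column_succ => q n; rewrite -[n](subrK 1).
move: (n - 1) => {}n pq pq2 x.
have pq0 : p + q == n + delta.
  by rewrite -(inj_eq (addIr 1)) addrAC (eqP pq) addrAC.
have pq2' : p + (q + 1) == n + 1 + delta by rewrite addrA addrAC.
have pq3 : p + (q + 1 + 1) == n + 1 + 1 + delta.
  by rewrite 2!addrA [p + q + 1]addrAC (eqP pq) addrAC.
have dF' := FF' _ _ pq0 pq pq2' (diff T (n + 1) x).
have dF'' := FF' _ _ pq2' pq2 pq3 x.
have dE := E_cycle pq0 pq pq2' x.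
rewrite diff_diff !linear0 addr0 in dF'.
rewrite defectE !(homB, homZ) tens_difflr sgS scaleNr opprK.
move: dE; rewrite dF' dF'' !(homD, homZ) tens_diffrK scaler0 addr0.
rewrite !scalerDr addrA !scalerA [sg p * c]mulrC => /addIr ->.
exact: subrr.
Qed.

(** The unknown column must account for [rest]. Applying the contraction [H] of T_p (x) T to [rest],
    with sign, gives a solution: [rest_cycle] turns the term with the differential of T into [H]
    after 1 (x) d, and the two halves of the contraction identity add up to [rest]. *)
Lemma column_prev p (F : column (p + 1)) (F' : column (p + 1 + 1)) :
  column_eq F F' -> exists F0, column_eq F0 F.
Proof.
move=> FF'; have [H HE] := tens_diffr_contraction ef hT p.
pose rest q n (pq : p + q == n + delta) (pq1 : p + 1 + q == n + 1 + delta) :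
    bimod_hom (T (n + 1)) (tens (T p) (T q)) :=
  comb_hom (-1) (comp_hom (tens_diffl T p q) (F _ _ pq1)) (E pq).
have restE q n (pq : p + q == n + delta) (pq1 : p + 1 + q == n + 1 + delta) x :
    rest q n pq pq1 x = E pq x - tens_diffl T p q (F _ _ pq1 x).
  by rewrite /= scaleN1r addrC.
have rest_cycle q n (pq : p + q == n + delta)
    (pq2 : p + (q + 1) == n + 1 + delta) (x : T (n + 1 + 1)) :
    c *: rest q n pq (sum_succl pq) (diff T (n + 1) x)
    = sg p *: tens_diffr T p q (rest (q + 1) (n + 1) pq2 (sum_succl pq2) x).
  have dF := FF' _ _ (sum_succl pq) (sum_succl (sum_succl pq)) (sum_succl pq2) x.
  have dE := E_cycle pq (sum_succl pq) pq2 x.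
  rewrite !restE !(homB, homZ) !scalerBr -dE dF.
  rewrite !(homD, homZ) tens_difflK add0r tens_difflr sgS scaleNr.
  by rewrite addrAC addrK addrC.
have G q n : exists h : bimod_hom (T (n + 1)) (tens (T p) (T (q + 1))),
    forall pq : p + q == n + delta, forall x,
    h x = sg p *: H q (rest q n pq (sum_succl pq) x).
  have [pq|npq] := pselect (p + q == n + delta); last first.
    by exists (zero_hom _ _) => pq; case: npq.
  exists (comb_hom (sg p) (comp_hom (H q) (rest q n pq (sum_succl pq))) (zero_hom _ _)).
  by move=> pq' x; rewrite (bool_irrelevance pq' pq) /= addr0.
have S q : exists F0 : forall n : int, p + (q + 1) == n + delta ->
    bimod_hom (T n) (tens (T p) (T (q + 1))),
    forall n, F0 (n + 1) = fun=> projT1 (cid (G q n)).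
  exact: (int_shift (X := fun n => p + (q + 1) == n + delta ->
    bimod_hom (T n) (tens (T p) (T (q + 1))))).
have [F0 F0E] := int_shift (X := fun q => forall n : int, p + q == n + delta ->
  bimod_hom (T n) (tens (T p) (T q))) (fun q => projT1 (cid (S q))).
have F0P q n (pq : p + q == n + delta) (pq2 : p + (q + 1) == n + 1 + delta) x :
    F0 (q + 1) (n + 1) pq2 x = sg p *: H q (rest q n pq (sum_succl pq) x).
  by rewrite F0E (projT2 (cid (S q))) (projT2 (cid (G q n)) pq).
exists F0 => q n; rewrite -[q](subrK 1) -[n](subrK 1).
move: (q - 1) (n - 1) => {}q {}n pq pq1 pq2 x.
have pq0 : p + q == n + delta.
  by rewrite -(inj_eq (addIr 1)) -addrA (eqP pq) addrAC.
rewrite (F0P _ _ pq) (F0P _ _ pq0) !homZ scalerA sgK scale1r.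
rewrite scalerA [c * _]mulrC -scalerA -[c *: H _ _]homZ.
rewrite (rest_cycle _ _ pq0 pq) homZ scalerA sgK scale1r -[RHS]addrA HE restE.
by rewrite (bool_irrelevance pq1 (sum_succl pq)) [tens_diffl _ _ _ _ + _]addrC subrK.
Qed.

Lemma tens_system (F0 : column 0) :
  (forall q n (pq : 0 + q == n + delta) (pq2 : 0 + (q + 1) == n + 1 + delta) x,
     eps_tens eps q (defect F0 pq pq2 x) = 0) ->
  exists F : forall p, column p, F 0 = F0 /\ forall p, column_eq (F p) (F (p + 1)).
Proof.
move=> dF0.
(* [-1 + 1] computes to 0, so [F0] is already a column of the required index. *)
have [|F1 F01] := @column_succ (-1) F0.
  by move=> q n pq pq2 x; apply: (tens_diffl_eps_eq0 hT); apply: dF0.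
apply: (int_chain (R := column_eq) (b := 0) (x1 := F1)) => //.
  by move=> p F F'; apply: column_next.
by move=> p F F'; apply: column_prev.
Qed.

End TensorSystem.

(** * Maps into products, and null-homotopic endomorphisms of T *)

Section ProductHoms.
Context (k : fieldType) (A : algType k) (I : Type) (M : I -> bimodType A).
Context (N : bimodType A).

Definition proj_hom (i : I) : bimod_hom (bimod_prod M) (M i) :=
  @mk_bimod_hom k A (bimod_prod M) (M i) (fun x => x i)
    (fun c x y => erefl) (fun a x => erefl) (fun x a => erefl).

Context (h : forall i, bimod_hom N (M i)).

Definition prod_hom_fun (x : N) : bimod_prod M := fun i => h i x.

Fact prod_hom_linear : linear prod_hom_fun.
Proof.
by move=> c x y; apply: functional_extensionality_dep => i; exact: hom_linear.
Qed.

Fact prod_hom_lact a x : prod_hom_fun (lact a x) = lact a (prod_hom_fun x).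
Proof. by apply: functional_extensionality_dep => i; exact: hom_lact. Qed.

Fact prod_hom_ract x a : prod_hom_fun (ract x a) = ract (prod_hom_fun x) a.
Proof. by apply: functional_extensionality_dep => i; exact: hom_ract. Qed.

Definition prod_hom : bimod_hom N (bimod_prod M) :=
  mk_bimod_hom prod_hom_linear prod_hom_lact prod_hom_ract.

End ProductHoms.

Section NullHomotopy.
Context (k : fieldType) (A : algType k) (m : nat) (lam : A -> k).
Context (e f : 'I_m -> A) (ef : dual_bases lam e f).
Context (T : complex A) (eps : bimod_hom (T 0) (regular_bimod A)).
Context (hT : complete_resolution eps).

Lemma lift_to_boundary q (u : bimod_hom (T (q + 1)) (T (q + 1))) :
  (forall x, diff T q (u x) = 0) ->
  exists h : bimod_hom (T (q + 1)) (T (q + 1 + 1)),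
    forall x, diff T (q + 1) (h x) = u x.
Proof.
move=> du; have [c [cL _ cK]] := linear_splitting ef hT.
have [th [thL thE]] := resolution_transfer ef hT (q + 1).
by apply: (hom_lift ef thL thE (cL (q + 1))) => x; apply: cK.
Qed.

Lemma extend_from_boundary q (u : bimod_hom (T (q + 1)) (T (q + 1))) :
  (forall x, u (diff T (q + 1) x) = 0) ->
  exists h : bimod_hom (T q) (T (q + 1)), forall x, h (diff T q x) = u x.
Proof.
move=> ud; have [c [cL cd cK]] := linear_splitting ef hT.
have [th [thL thE]] := resolution_transfer ef hT (q + 1).
apply: (hom_extend ef (v := u \o c q) thL thE) => [a x y|x] /=.
  by rewrite cL linearP.
apply/esym/eqP; rewrite -subr_eq0 -homB -[x - _]cK ?ud //.
by rewrite homB cd subrr.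
Qed.

(** As d_0 = eta eps, [g 0] takes values in cycles and lifts to [h0]. The remaining maps come from
    lifting upwards and extension downwards. *)
Lemma null_homotopy (g : forall q, bimod_hom (T q) (T q)) :
  (forall q x, g q (diff T q x) = diff T q (g (q + 1) x)) ->
  (forall x, eps (g 0 x) = 0) ->
  exists h : forall q, bimod_hom (T q) (T (q + 1)), forall q x,
    g (q + 1) x = diff T (q + 1) (h (q + 1) x) + h q (diff T q x).
Proof.
move=> gd eg.
have [|h0 h0E] := @lift_to_boundary (-1) (g 0).
  move=> x; case: hT => _ _ _ [eta [_ etaE]].
  by rewrite (etaE (g 0 x)) eg linear0.
(* The homotopy is taken to be zero out of degree -1. *)
have base (x : T (-1 + 1)) : g (-1 + 1) x =
    diff T (-1 + 1) (h0 x) + zero_hom (T (-1)) (T (-1 + 1)) (diff T (-1) x).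
  by rewrite h0E addr0.
have [||h [_ hP]] := int_chain (X := fun q => bimod_hom (T q) (T (q + 1)))
  (R := fun q s s' => forall x,
     g (q + 1) x = diff T (q + 1) (s' x) + s (diff T q x)) base.
- move=> q s s' ss'.
  have [|h hE] := @lift_to_boundary (q + 1)
      (comb_hom (-1) (comp_hom s' (diff T (q + 1))) (g (q + 1 + 1))).
    move=> x; rewrite comb_homN homB -gd ss'.
    by rewrite diff_diff linear0 addr0 subrr.
  by exists h => x; rewrite hE comb_homN subrK.
- move=> q s' s'' ss'.
  have [|h hE] := @extend_from_boundary q
      (comb_hom (-1) (comp_hom (diff T (q + 1)) s') (g (q + 1))).
    move=> x; rewrite comb_homN gd ss' homD diff_diff add0r.
    exact: subrr.
  by exists h => x; rewrite hE comb_homN [RHS]addrC subrK.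
by exists h.
Qed.

End NullHomotopy.

(** * Existence and uniqueness of diagonal approximations *)

Section Comparison.
Context (k : fieldType) (A : algType k) (m : nat) (lam : A -> k).
Context (e f : 'I_m -> A) (ef : dual_bases lam e f).
Context (T : complex A) (eps : bimod_hom (T 0) (regular_bimod A)).
Context (hT : complete_resolution eps).

Definition antidiag_sum n (s : antidiag n) : adl s + adr s == n :=
  let: Antidiag p q pq := s return adl s + adr s == n in pq.

(** [J] prescribes column 0 after eps (x) 1. Composing it with sections [S q] gives column 0 itself;
    these need not commute with differentials, as the defect only has to vanish after eps (x) 1. *)
Lemma tens_system_over (c : k) (delta : int)
    (E : forall p q n : int,
      p + q == n + delta -> bimod_hom (T (n + 1)) (tens (T p) (T q)))
    (J : forall q n : int, q = n + delta -> bimod_hom (T n) (T q)) :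
  (forall p q n (pq : p + q == n + delta) (pq1 : p + 1 + q == n + 1 + delta)
      (pq2 : p + (q + 1) == n + 1 + delta) (x : T (n + 1 + 1)),
    tens_diffl T p q (E _ _ _ pq1 x) + (-1 : k) ^ p *: tens_diffr T p q (E _ _ _ pq2 x)
    = c *: E _ _ _ pq (diff T (n + 1) x)) ->
  (forall q n (pq : 0 + q == n + delta) (Jq : q = n + delta)
      (Jq1 : q + 1 = n + 1 + delta) x,
    eps_tens eps q (E _ _ _ pq x)
    = diff T q (J _ _ Jq1 x) + c *: J _ _ Jq (diff T n x)) ->
  exists F : forall p, column T delta p,
    (forall p, column_eq c E (F p) (F (p + 1))) /\
    forall q n (pq : 0 + q == n + delta) (Jq : q = n + delta) x,
      eps_tens eps q (F 0 q n pq x) = J _ _ Jq x.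
Proof.
move=> Ecyc EJ.
pose S q := projT1 (cid (eps_tens_section hT q)).
have SE q y : eps_tens eps q (S q y) = y by rewrite /S; case: cid.
have Jeq q n (pq : 0 + q == n + delta) : q = n + delta.
  by rewrite -(eqP pq) add0r.
pose F0 : column T delta 0 := fun q n pq => comp_hom (S q) (J q n (Jeq q n pq)).
have [|F [F0E FP]] := tens_system ef hT (c := c) Ecyc (F0 := F0).
  move=> q n pq pq2 x.
  rewrite defectE expr0z scale1r !homB homZ eps_tens_diffr !SE.
  rewrite (EJ _ _ _ (Jeq q n pq) (Jeq _ _ pq2)).
  by rewrite -[LHS]addrA -opprD subrr.
exists F; split=> // q n pq Jq x; rewrite F0E SE.
by rewrite (eq_irrelevance Jq (Jeq q n pq)).
Qed.

Lemma diagonal_approximation_exists :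
  exists Delta : chain_map T (ctens T T), diagonal_approximation eps Delta.
Proof.
(* The identity of T, transported because [n + 0] is not [n] by computation. *)
pose J q n (qn : q = n + 0) : bimod_hom (T n) (T q) :=
  ecast i (bimod_hom (T n) (T i)) (esym (etrans qn (addr0 n))) (id_hom (T n)).
have JE n (nn : n = n + 0) x : J n n nn x = x.
  by rewrite /J (eq_irrelevance (esym _) erefl).
have [||F [FP F0]] := @tens_system_over (-1) 0 (fun _ _ _ _ => zero_hom _ _) J.
- by move=> p q n _ _ _ x; rewrite !zero_homE !hom0 !scaler0 addr0.
- move=> q n _ Jq; have nq : n = q by rewrite Jq addr0.
  case: q / nq Jq => Jq Jq1 x.
  by rewrite zero_homE hom0 !JE scaleN1r subrr.
have idx n (s : antidiag n) : adl s + adr s == n + 0 by rewrite addr0 antidiag_sum.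
pose D n : bimod_hom (T n) (ctens T T n) :=
    prod_hom (fun s : antidiag n => F (adl s) (adr s) n (idx n s)).
have DP n (x : T (n + 1)) : D n (diff T n x) = @ctens_diff k A T T n (D (n + 1) x).
  apply: functional_extensionality_dep => -[p q pq].
  rewrite ctens_diffE.
  have := FP p q n (idx _ (Antidiag pq)) (idx _ (Antidiag (antidiagSl pq)))
    (idx _ (Antidiag (antidiagSr pq))) x.
  by move/esym/eqP; rewrite scaleN1r subr_eq0 => /eqP.
exists (ChainMap (chain_fun := D) DP) => x.
rewrite /ctens_augmentation (tens_unit_eps eps).
by rewrite (F0 0 0 _ (esym (addr0 0))) JE.
Qed.

(** The difference of the two maps, followed by eps (x) 1, is a chain endomorphism of T killed by
    eps in degree 0. A null-homotopy of it prescribes column 0 of the homotopy sought. *)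
Lemma diagonal_approximation_unique (Delta Delta' : chain_map T (ctens T T)) :
  diagonal_approximation eps Delta -> diagonal_approximation eps Delta' ->
  homotopic Delta Delta'.
Proof.
move=> DeltaE DeltaE'.
pose G n (s : antidiag n) : bimod_hom (T n) (tens (T (adl s)) (T (adr s))) :=
  comb_hom (-1) (comp_hom (proj_hom _ s) (Delta' n))
    (comp_hom (proj_hom _ s) (Delta n)).
have GE n (s : antidiag n) x : G n s x = Delta n x s - Delta' n x s.
  by rewrite comb_homN.
have GP n (p q : int) (pq : p + q == n) (pq1 : p + 1 + q == n + 1)
    (pq2 : p + (q + 1) == n + 1) (x : T (n + 1)) :
    tens_diffl T p q (G _ (Antidiag pq1) x)
    + (-1 : k) ^ p *: tens_diffr T p q (G _ (Antidiag pq2) x)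
    = G _ (Antidiag pq) (diff T n x).
  rewrite (bool_irrelevance pq1 (antidiagSl pq)) (bool_irrelevance pq2 (antidiagSr pq)).
  by rewrite !GE !chain_comm !ctens_diffE !homB scalerBr opprD addrACA.
have idx0 (q : int) : 0 + q == q by rewrite add0r.
pose g q := comp_hom (eps_tens eps q) (G q (Antidiag (idx0 q))).
have [||s sE] := @null_homotopy _ _ _ _ _ _ ef _ _ hT g.
- move=> q x.
  have GS := GP q 0 q (idx0 q) (antidiagSl (idx0 q)) (antidiagSr (idx0 q)) x.
  transitivity (eps_tens eps q (G q (Antidiag (idx0 q)) (diff T q x))) => //.
  rewrite -GS expr0z scale1r homD (eps_tens_diffl hT) add0r eps_tens_diffr.
  by rewrite (bool_irrelevance (antidiagSr (idx0 q)) (idx0 (q + 1))).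
- move=> x.
  transitivity (eps (eps_tens eps 0 (G 0 (Antidiag (idx0 0)) x))) => //.
  rewrite GE !homB (bool_irrelevance (idx0 0) (eqxx 0)) -!tens_unit_eps.
  have := DeltaE x; have := DeltaE' x; rewrite /ctens_augmentation => -> ->.
  exact: subrr.
(* With [delta] equal to 1, the prescribed map out of T_n lands in T_(n+1), as the null-homotopy [s]
   does. *)
pose J q n (qn : q = n + 1) : bimod_hom (T n) (T q) :=
  ecast i (bimod_hom (T n) (T i)) (esym qn) (s n).
have [||F [FP _]] := @tens_system_over 1 1
  (fun p q n (pq : p + q == n + 1) => G _ (Antidiag pq)) J.
- by move=> p q n pq pq1 pq2 x; rewrite scale1r; exact: GP.
- move=> q n pq Jq; subst q => Jq1 x.
  rewrite /J (eq_irrelevance Jq1 erefl) scale1r -sE.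
  by rewrite (bool_irrelevance pq (idx0 _)).
exists (fun n => prod_hom (fun s : antidiag (n + 1) =>
  F (adl s) (adr s) n (antidiag_sum s))).
move=> n x; apply: functional_extensionality_dep => -[p q pq].
have := FP p q n pq (antidiagSl pq) (antidiagSr pq) x; rewrite scale1r GE => E.
exact: E.
Qed.

End Comparison.

Theorem theorem3p6 (k : fieldType) (A : falgType k) (hA : frobenius A)
    (T : complex A) (eps : bimod_hom (T 0) (regular_bimod A))
    (hT : complete_resolution eps) :
  (exists Delta : chain_map T (ctens T T), diagonal_approximation eps Delta) /\
  (forall Delta Delta' : chain_map T (ctens T T),
     diagonal_approximation eps Delta -> diagonal_approximation eps Delta' ->
     homotopic Delta Delta').
Proof.
have [n [lam [e [f ef]]]] := frobenius_dual_bases hA.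
split; first exact: (diagonal_approximation_exists ef hT).
by move=> Delta Delta'; exact: (diagonal_approximation_unique ef hT).
Qed.
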